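(* Every (4,6)-fullerene graph $G$ is of one of the following five types: (i) the cube; (ii) the hexagonal prism; (iii) a tubular graph $T_t$ with at least one hexagon-layer, i.e. $G\in\mathcal{T}$; (iv) a (4,6)-fullerene graph of lantern structure; (v) a (4,6)-fullerene graph of dispersive structure.
   Context: A (4,6)-fullerene graph is a plane 3-regular graph all of whose faces are bounded by 4-cycles (square faces) or 6-cycles (hexagonal faces), with exactly six square faces. Three square faces are arranged in a line if $G$ contains eight distinct vertices $v_1,\dots,v_4,u_1,\dots,u_4$ such that for $i=1,2,3$ the cycle $v_iv_{i+1}u_{i+1}u_iv_i$ bounds a square face. A square-cap in $G$ is a subgraph consisting of a 6-cycle $u_1\cdots u_6u_1$ together with a vertex $w$ adjacent to $u_1,u_3,u_5$. The hexagonal prism is $C_6\square K_2$. For $t\geqslant 0$, $T_t$ is the plane cubic graph with vertices $a,b$, $c_{i,j}$ ($0\leqslant i\leqslant t$, $1\leqslant j\leqslant 6$), 6-cycles $c_{i,1}\cdots c_{i,6}c_{i,1}$, edges $ac_{0,j}$ for odd $j$, $c_{i,j}c_{i+1,j}$ for $0\leqslant i<t$ and $j\equiv i\pmod 2$, and $bc_{t,j}$ for $j\equiv t\pmod 2$ ($t$ layers of three hexagons capped by three squares at each end; $T_0$ is the cube); $\mathcal{T}=\{T_t:t\geqslant1\}$. $G$ is of lantern structure if it is neither the cube nor the hexagonal prism and its six square faces split into two groups of three square faces, each group arranged in a line. $G$ is of dispersive structure if it has neither three square faces arranged in a line nor a square-cap. *)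

(* Defs.v *)
From mathcomp Require Import all_boot fingroup perm.

Set Implicit Arguments.
Unset Strict Implicit.
Unset Printing Implicit Defensive.

Definition isomorphic (V W : finType) (e : rel V) (e' : rel W) : Prop :=
  exists f : V -> W, bijective f /\ forall x y, e' (f x) (f y) = e x y.

Section RotationSystem.

(* [r v] turns around [v]: it sends a neighbour of [v] to the next one in the
   cyclic order of the edges at [v]; its values off the neighbours of [v] are
   irrelevant. *)
Variables (V : finType) (e : rel V) (r : V -> {perm V}).

Definition neighbours (v : V) : {set V} := [set w | e v w].

Definition darts : {set V * V} := [set d | e d.1 d.2].

Definition edges : {set {set V}} := [set [set d.1; d.2] | d in darts].

Definition face_next (d : V * V) : V * V := (d.2, r d.2 d.1).

(* A face is represented by the set of darts met when tracing its boundary,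
   each edge being traversed with the face always on the same side. *)
Definition faces : {set {set V * V}} :=
  [set [set d' | fconnect face_next d d'] | d in darts].

End RotationSystem.

(* A connected simple plane graph with at least one edge, given up to
   homeomorphism of the sphere by its rotation system; planarity is Euler's
   formula. *)
Record plane_graph := PlaneGraph {
  vertex : finType;
  adj : rel vertex;
  rotation : vertex -> {perm vertex};
  adj_sym : symmetric adj;
  adj_irrefl : irreflexive adj;
  rotation_cyclic : forall v w,
    adj v w -> porbit (rotation v) w = neighbours adj v;
  adj_connected : forall v w, connect adj v w;
  euler_formula :
    #|vertex| + #|faces adj rotation| = #|edges adj| + 2
}.

Section PlaneGraph.

Variable G : plane_graph.
Implicit Types (F : {set vertex G * vertex G}) (c : seq (vertex G)).

Definition face_set : {set {set vertex G * vertex G}} :=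
  faces (@adj G) (@rotation G).

Definition cycle_darts c : {set vertex G * vertex G} :=
  [set d in zip c (rot 1 c)].

(* The cycle may be listed in either direction, whereas the darts of a face
   are all traversed in the same one. *)
Definition bounds c F : bool :=
  [&& uniq c, 2 < size c &
      (F == cycle_darts c) || (F == cycle_darts (rev c))].

Definition bounded_by_cycle (n : nat) F : bool :=
  [exists c : n.-tuple (vertex G), bounds c F].

Definition square_faces : {set {set vertex G * vertex G}} :=
  [set F in face_set | bounded_by_cycle 4 F].

Definition is_46_fullerene : Prop :=
  [/\ forall v : vertex G, #|neighbours (@adj G) v| = 3,
      forall F, F \in face_set -> bounded_by_cycle 4 F || bounded_by_cycle 6 F
    & #|square_faces| = 6].

Definition in_line F1 F2 F3 : Prop :=
  exists v1 v2 v3 v4 u1 u2 u3 u4 : vertex G,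
  [/\ uniq [:: v1; v2; v3; v4; u1; u2; u3; u4],
      [/\ F1 \in square_faces, F2 \in square_faces & F3 \in square_faces],
      bounds [:: v1; v2; u2; u1] F1,
      bounds [:: v2; v3; u3; u2] F2
    & bounds [:: v3; v4; u4; u3] F3].

Definition has_three_in_line : Prop := exists F1 F2 F3, in_line F1 F2 F3.

Definition has_square_cap : Prop :=
  exists u1 u2 u3 u4 u5 u6 w : vertex G,
  [/\ uniq [:: w; u1; u2; u3; u4; u5; u6],
      path.cycle (@adj G) [:: u1; u2; u3; u4; u5; u6]
    & [/\ adj w u1, adj w u3 & adj w u5]].

End PlaneGraph.

Definition complete_adj (n : nat) : rel 'I_n := fun i j => i != j.

(* The cycle C_n, for n >= 3. *)
Definition cycle_adj (n : nat) : rel 'I_n :=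
  fun i j => (j == i.+1 %% n :> nat) || (i == j.+1 %% n :> nat).

Definition cartesian_adj (V W : finType) (e : rel V) (e' : rel W) :
    rel (V * W)%type :=
  fun x y => ((x.1 == y.1) && e' x.2 y.2) || (e x.1 y.1 && (x.2 == y.2)).

Definition cube_adj : rel ('I_2 * 'I_2 * 'I_2)%type :=
  cartesian_adj (cartesian_adj (@complete_adj 2) (@complete_adj 2))
                (@complete_adj 2).

Definition hexagonal_prism_adj : rel ('I_6 * 'I_2)%type :=
  cartesian_adj (@cycle_adj 6) (@complete_adj 2).

(* [inl false] is a, [inl true] is b and [inr (i, j)] is c_{i,j}, where the
   second index, which runs over 1..6 on paper, is read modulo 6 (so 6 is 0);
   this preserves its parity. *)
Definition tube_vertex (t : nat) : finType := (bool + 'I_t.+1 * 'I_6)%type.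

Definition tube_arc (t : nat) (x y : tube_vertex t) : bool :=
  match x, y with
  | inl false, inr (i, j) => (i == 0 :> nat) && odd j
  | inr (i, j), inr (i', j') =>
      ((i == i') && cycle_adj j j')
      || [&& i' == i.+1 :> nat, j == j' & odd j == odd i]
  | inr (i, j), inl true => (i == t :> nat) && (odd j == odd t)
  | _, _ => false
  end.

Definition tube_adj (t : nat) : rel (tube_vertex t) :=
  fun x y => tube_arc x y || tube_arc y x.

Section Types.

Variable G : plane_graph.

Definition is_cube : Prop := isomorphic (@adj G) cube_adj.

Definition is_hexagonal_prism : Prop :=
  isomorphic (@adj G) hexagonal_prism_adj.

Definition is_tubular : Prop :=
  exists t : nat, 1 <= t /\ isomorphic (@adj G) (@tube_adj t).

Definition lantern_structure : Prop :=
  [/\ ~ is_cube, ~ is_hexagonal_prism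
    & exists F1 F2 F3 F4 F5 F6 : {set vertex G * vertex G},
      [/\ perm_eq (enum (square_faces G)) [:: F1; F2; F3; F4; F5; F6],
          in_line F1 F2 F3
        & in_line F4 F5 F6]].

Definition dispersive_structure : Prop :=
  ~ has_three_in_line G /\ ~ has_square_cap G.

End Types.

(* Main.v *)
Require Import Defs.
From mathcomp Require Import all_boot fingroup perm all_algebra zify.
From Stdlib Require Import Classical.

Set Implicit Arguments.
Unset Strict Implicit.
Unset Printing Implicit Defensive.

(** Euler's formula says that over F_2 the face boundaries span the cycle
    space, which is a combinatorial Jordan theorem: a closed walk separates the
    faces into two sides. Applied to the three 4-cycles of a square-cap, together
    with the absence of bridges, it shows that they bound square faces.

    From there on the argument is local. The boundary of a square-cap is a
    6-cycle of which every other vertex has an edge to the outside. Three faces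
    surround it; they are all squares, and the graph closes up, or all hexagons,
    and they form a new layer with a boundary of the same kind. Finiteness makes
    the growth stop, and the graph is T_t, with T_0 the cube.

    Three squares in a line have as boundary an 8-cycle with four outgoing edges;
    the two faces that meet it along three consecutive edges are both hexagons,
    and the boundary grows to one of the same kind, or both squares. In the second
    case the graph closes up with three new squares in a line, unless this happens
    at once, and then there is a square-cap. *)

(** * Rotation systems *)

(** A vertex of a cycle without repetition is the source of only one of its darts; this lets the
    rotation be read off from the cycle. *)
Lemma zip_functional (T U : eqType) (s : seq T) (t : seq U) p q q' :
  uniq s -> (p, q) \in zip s t -> (p, q') \in zip s t -> q = q'.
Proof.
elim: s t => [|x s IH] [|y t] //= /andP[xNs us].
have memz z u : (z, u) \in zip s t -> z \in s.
  elim: s t {IH xNs us} => [|x' s IH] [|y' t] //=.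
  by rewrite !inE xpair_eqE => /orP[/andP[-> //]|/IH ->]; rewrite orbT.
rewrite !inE !xpair_eqE => /orP[/andP[/eqP-> /eqP->]|h1]
  /orP[/andP[/eqP e1 /eqP e2]|h2] //.
- by case/negP: xNs; apply: memz h2.
- by case/negP: xNs; rewrite -e1; apply: memz h1.
- exact: IH h1 h2.
Qed.

Lemma fconnect_iter (T : finType) (f : T -> T) x y :
  fconnect f x y -> exists n, iter n f x = y.
Proof. by move/iter_findex=> <-; eexists. Qed.

Section Rotation.

Variable G : plane_graph.
Local Notation V := (vertex G).
Local Notation e := (@adj G).
Local Notation r := (@rotation G).
Local Notation fn := (face_next r).
Implicit Types (a b c d v w x y z : V).

Lemma face_next_inj : injective fn.
Proof. by move=> [a b] [c d] [<-] /perm_inj->. Qed.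

Lemma adj_rotation a b : e a b -> e b (r b a).
Proof.
rewrite adj_sym => h; have := rotation_cyclic h.
move/setP/(_ (r b a)); rewrite inE => <-.
exact: (mem_porbit (r b) 1 a).
Qed.

(** [r b a = c] says that the face entering [b] from [a] leaves towards [c]. The boundary thus
    carries a direction, which [bounds] leaves open. *)
Definition square a b c d : Prop :=
  [/\ uniq [:: a; b; c; d], r b a = c, r c b = d, r d c = a & r a d = b].

Definition hexagon a b c d x y : Prop :=
  [/\ uniq [:: a; b; c; d; x; y],
      [/\ r b a = c, r c b = d & r d c = x]
    & [/\ r x d = y, r y x = a & r a y = b]].

Lemma square_rot a b c d : square a b c d -> square b c d a.
Proof. by case=> u h1 h2 h3 h4; split=> //; rewrite -(rot_uniq 3). Qed.

Lemma hexagon_rot a b c d x y : hexagon a b c d x y -> hexagon b c d x y a.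
Proof. by case=> u [h1 h2 h3] [h4 h5 h6]; split=> //; rewrite -(rot_uniq 5). Qed.

Lemma face_next_stable F (p q : V) : F \in face_set G -> (p, q) \in F ->
  (q, r q p) \in F.
Proof.
case/imsetP=> d0 _ -> {F}; rewrite !inE => h.
exact: connect_trans h (fconnect1 fn (p, q)).
Qed.

Lemma face_adj F (p q : V) : F \in face_set G -> (p, q) \in F -> e p q.
Proof.
case/imsetP=> d0; rewrite inE => h0 -> {F}; rewrite inE.
case/fconnect_iter=> n; elim: n p q => [|n IH] p q /=.
  by move=> E; move: h0; rewrite E.
case E : (iter n fn d0) => [p' q'] [<- <-]; exact/adj_rotation/IH.
Qed.

Lemma face_mem_eq F (d : V * V) : F \in face_set G -> d \in F ->
  F = [set d' | fconnect fn d d'].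
Proof.
case/imsetP=> d0 _ -> {F}; rewrite inE => h; apply/setP=> d'; rewrite !inE.
exact: (same_connect (fconnect_sym face_next_inj)).
Qed.

Lemma cycle_darts4 a b c d :
  cycle_darts [:: a; b; c; d] =i [:: (a, b); (b, c); (c, d); (d, a)].
Proof. by move=> p; rewrite inE. Qed.

(** The dart [(q, r q p)] that follows [(p, q)] stays in [F], and [F] has a single dart leaving [q],
    so the rotation follows the cycle. *)
Lemma face_square a b c d F : F \in face_set G -> uniq [:: a; b; c; d] ->
  F = cycle_darts [:: a; b; c; d] -> square a b c d /\ e a b.
Proof.
move=> FG u EF; have mF p : p \in zip [:: a; b; c; d] [:: b; c; d; a] -> p \in F.
  by move=> h; rewrite EF inE.

have key p q q' : (p, q) \in F -> (p, q') \in F -> q = q'.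
  by rewrite EF !inE => h1 h2;
     apply: (@zip_functional _ _ _ [:: b; c; d; a] p _ _ u);
     rewrite /= !inE.
have rE p q s : (p, q) \in zip [:: a; b; c; d] [:: b; c; d; a] ->
   (q, s) \in zip [:: a; b; c; d] [:: b; c; d; a] -> r q p = s.
  by move=> /mF h1 /mF; apply: key; apply: face_next_stable.
split; last by apply: (face_adj FG); apply: mF; rewrite inE eqxx.
by split=> //; apply: rE; rewrite !inE eqxx ?orbT.
Qed.

Lemma face_hexagon a b c d x y F : F \in face_set G ->
  uniq [:: a; b; c; d; x; y] ->
  F = cycle_darts [:: a; b; c; d; x; y] -> hexagon a b c d x y.
Proof.
move=> FG u EF; pose z := zip [:: a; b; c; d; x; y] [:: b; c; d; x; y; a].
have mF p : p \in z -> p \in F by move=> h; rewrite EF inE.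
have key p q q' : (p, q) \in F -> (p, q') \in F -> q = q'.
  by rewrite EF !inE => h1 h2;
     apply: (@zip_functional _ _ _ [:: b; c; d; x; y; a] p _ _ u);
     rewrite /= !inE.
have rE p q s : (p, q) \in z -> (q, s) \in z -> r q p = s.
  by move=> /mF h1 /mF; apply: key; apply: face_next_stable.
by split=> //; split; apply: rE; rewrite !inE eqxx ?orbT.
Qed.

Lemma square_face a b c d : e a b -> square a b c d ->
  cycle_darts [:: a; b; c; d] \in square_faces G.
Proof.
move=> eab [u h1 h2 h3 h4]; rewrite inE; apply/andP; split; last first.
  by apply/existsP; exists [tuple a; b; c; d]; apply/and3P; split; rewrite ?eqxx.
apply/imsetP; exists (a, b); first by rewrite inE.
apply/setP=> p; rewrite cycle_darts4 inE; apply/idP/idP.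
  rewrite !inE => /or4P[] /eqP->.
  - exact: connect0.
  - by apply: connect1; rewrite /= /face_next /= h1.
  - by apply/connectP; exists [:: (b, c); (c, d)];
      rewrite //= /face_next /= h1 h2 !eqxx.
  - by apply/connectP; exists [:: (b, c); (c, d); (d, a)];
      rewrite //= /face_next /= h1 h2 h3 !eqxx.
rewrite inE => /fconnect_iter[n]; elim: n p => [|n IH] p /=.
  by move=> <-; rewrite inE eqxx.
move=> <-; have := IH _ erefl; rewrite !inE => /or4P[] /eqP->;
  by rewrite /face_next /= ?h1 ?h2 ?h3 ?h4 eqxx ?orbT.
Qed.

End Rotation.

(** * Sides of a closed walk *)

Section Jordan.

Import GRing.Theory.
Local Open Scope ring_scope.

Variable G : plane_graph.
Local Notation V := (vertex G).
Local Notation e := (@adj G).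
Local Notation r := (@rotation G).
Local Notation fn := (face_next r).
Local Notation E := (edges e).
Local Notation F := (face_set G).
Local Notation edge d := ([set d.1; d.2] : {set V}).

Lemma addFF2 (x : 'F_2) : x + x = 0.
Proof. by apply: addrr_pchar2; rewrite pchar_Fp. Qed.

Lemma sum_enum_val_eq (T : finType) (A : {set T}) x (g : T -> 'F_2) : x \in A ->
  \sum_(j < #|A|) (x == enum_val j)%:R * g (enum_val j) = g x.
Proof.
move=> xA; rewrite -(big_enum_val (fun y => (x == y)%:R * g y)) /=.
rewrite (bigD1 x) //= eqxx mul1r big1 ?addr0 // => y /andP[_ /negPf].
by rewrite eq_sym => ->; rewrite mul0r.
Qed.

Lemma edge_mem a b : e a b -> [set a; b] \in E.
Proof. by move=> h; apply/imsetP; exists (a, b); rewrite ?inE. Qed.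

Definition incidence_mx : 'M['F_2]_(#|E|, #|V|) :=
  \matrix_(j < #|E|, k < #|V|) (enum_val k \in (enum_val j : {set V}))%:R.

(** An edge both of whose darts lie in the same face gets the coefficient [1 + 1 = 0] there. *)
Definition boundary_mx : 'M['F_2]_(#|F|, #|E|) :=
  \matrix_(i < #|F|, j < #|E|)
    \sum_(d in (enum_val i : {set V * V})) (edge d == enum_val j)%:R.

(** The dart of an edge lies in exactly one face, and this is the value of [g] at that face. *)
Definition dart_value (g : 'rV['F_2]_#|F|) (d : V * V) : 'F_2 :=
  \sum_i g 0 i * (d \in (enum_val i : {set V * V}))%:R.

Lemma set2_natr (v a b : V) : a != b ->
  (v \in [set a; b])%:R = (v == a)%:R + (v == b)%:R :> 'F_2.
Proof.
move=> ab; rewrite !inE; case: (v =P a) => [->|_]; last by rewrite add0r.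
by rewrite (negPf ab) addr0.
Qed.

(** Each dart of a face contributes its source and its target, and the target is the source of the
    next dart. Since [face_next] permutes the face, every vertex is counted an even number of
    times. *)
Lemma boundary_incidence : boundary_mx *m incidence_mx = 0.
Proof.
apply/matrixP=> i k; rewrite !mxE.
under eq_bigr => j _ do rewrite !mxE mulr_suml.
rewrite exchange_big /=; set v := enum_val k.
have Fi : enum_val i \in F by apply: enum_valP.
have dE d : d \in enum_val i -> e d.1 d.2.
  by case: d => p q; apply: face_adj.
rewrite (eq_bigr (fun d => (d.1 == v)%:R + ((fn d).1 == v)%:R)); last first.
  move=> d /dE h; rewrite (@sum_enum_val_eq _ _ _ (fun f : {set V} => (v \in f)%:R));
    last exact: edge_mem.
  rewrite set2_natr 1?[v == _]eq_sym 1?[v == d.2]eq_sym //.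
  by apply/eqP=> E; move: h; rewrite E adj_irrefl.
rewrite big_split /= [X in X + _](reindex_inj (@face_next_inj G)) /=.
rewrite (eq_bigl (mem (enum_val i))) ?addFF2 // => -[p q] /=.
by have /imsetP[d0 _ ->] := Fi; rewrite !inE -(same_fconnect1_r (@face_next_inj G)).
Qed.

Lemma dart_value_face g a b : dart_value g (b, r b a) = dart_value g (a, b).
Proof.
apply: eq_bigr => i _; have /imsetP[d0 _ ->] : enum_val i \in F by apply: enum_valP.
by rewrite !inE (same_fconnect1_r (@face_next_inj G) d0 (a, b)).
Qed.

(** Only the darts [(a, b)] and [(b, a)] lie over the edge, so its coefficient adds the values of
    [g] at the faces on its two sides. *)
Lemma mul_boundary g j a b : e a b -> enum_val j = [set a; b] ->
  (g *m boundary_mx) 0 j = dart_value g (a, b) + dart_value g (b, a).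
Proof.
move=> eab Ej; rewrite !mxE.
have ab : a != b by apply/eqP=> h; move: eab; rewrite h adj_irrefl.
under eq_bigr => i _ do rewrite mxE mulr_sumr.
under eq_bigr => i _ do rewrite big_mkcond.
rewrite exchange_big /= (bigD1 (a, b)) //= (bigD1 (b, a)) /=; last first.
  by rewrite xpair_eqE (negPf ab) andbF.
rewrite [X in _ + (_ + X)]big1 ?addr0 => [|[p q] /andP[/= h1 h2]].
  congr (_ + _); apply: eq_bigr => i _; rewrite Ej; case: ifP; rewrite ?mulr0 //.
    by rewrite eqxx.
  by rewrite setUC eqxx.
apply: big1 => i _; case: ifP => // pqi.
have /(face_adj (enum_valP i)) epq := pqi.
suff /negPf-> : [set p; q] != enum_val j by rewrite mulr0.
apply/eqP; rewrite Ej => /setP H.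
have := H p; have := H q; rewrite !inE !eqxx orbT /= => /esym hq /esym hp.
case/orP: hp => /eqP hp; case/orP: hq => /eqP hq;
  by move: h1 h2 epq; rewrite hp hq ?adj_irrefl ?eqxx.
Qed.

Hypothesis nonempty : exists a b, e a b.

(** Reversing a dart and then taking a face step turns around a vertex, which reaches all the darts
    there. A path in the connected graph then carries the value from vertex to vertex. *)
Lemma dart_connected (T : Type) (h : V * V -> T) :
  (forall a b, e a b -> h (b, r b a) = h (a, b)) ->
  (forall a b, e a b -> h (a, b) = h (b, a)) ->
  forall a b c d, e a b -> e c d -> h (a, b) = h (c, d).
Proof.
move=> hf hr a b c d eab ecd.
have hv v x y : e v x -> e v y -> h (v, y) = h (v, x).
  move=> evx; have := rotation_cyclic evx => /setP/(_ y); rewrite inE => <-.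
  case/porbitP=> n ->; elim: n => [|n IH]; first by rewrite expg0 perm1.
  rewrite expgSr permM; set z := (r v ^+ n)%g x in IH *.
  have evz : e v z.
    by have /setP/(_ z) := rotation_cyclic evx; rewrite inE mem_porbit.
  by rewrite (hf z v) ?[e z v]adj_sym // -(hr v z).
case/connectP: (adj_connected a c) => p; elim: p a b eab => [|x p IH] a b eab /=.
  by move=> _ Ec; rewrite Ec in ecd *; apply: hv.
case/andP=> eax ep lp; rewrite (hv a x b) // (hr a x) //.
by apply: IH => //; rewrite adj_sym.
Qed.

(** If [g] has zero boundary, its dart values agree on the two sides of every edge, so they are
    constant: the kernel is at most a line. *)
Lemma rank_boundary : (#|F|.-1 <= \rank boundary_mx)%N.
Proof.
have [a0 [b0 e0]] := nonempty.
suff: (\rank (kermx boundary_mx) <= 1)%N.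
  by rewrite mxrank_ker -subn1 !leq_subLR addnC.
apply: leq_trans (rank_leq_row (const_mx 1 : 'rV_#|F|)); apply: mxrankS.
apply/rV_subP=> g /sub_kermxP gM.
suff -> : g = dart_value g (a0, b0) *: const_mx 1 by apply: scalemx_sub.
apply/rowP=> i; rewrite !mxE mulr1.
have Fi : enum_val i \in F by apply: enum_valP.
have /imsetP[[a b] ab iE] := Fi; rewrite inE /= in ab.
have -> : g 0 i = dart_value g (a, b).
  rewrite /dart_value (bigD1 i) //= iE inE connect0 mulr1 big1 ?addr0 // => k ki.
  case: (boolP ((a, b) \in enum_val k)) => h; rewrite ?mulr0 //.
  case/eqP: ki; apply: enum_val_inj; rewrite iE.
  by apply: face_mem_eq => //; apply: enum_valP.
apply: dart_connected => // [p q _|p q epq]; first exact: dart_value_face.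
have := mul_boundary g epq (enum_rankK_in (edge_mem epq) (edge_mem epq)).
rewrite gM mxE => /esym/eqP; rewrite addr_eq0 => /eqP->.
by apply/eqP; rewrite eq_sym -addr_eq0 addFF2.
Qed.

(** A vector killed by the transpose takes equal values at the two ends of every edge, hence is
    constant by connectedness. *)
Lemma rank_incidence : (#|V|.-1 <= \rank incidence_mx)%N.
Proof.
have [a0 [b0 e0]] := nonempty.
rewrite -mxrank_tr.
suff: (\rank (kermx incidence_mx^T) <= 1)%N.
  by rewrite mxrank_ker -subn1 !leq_subLR addnC.
apply: leq_trans (rank_leq_row (const_mx 1 : 'rV_#|V|)); apply: mxrankS.
apply/rV_subP=> g /sub_kermxP gM.
suff -> : g = g 0 (enum_rank a0) *: const_mx 1 by apply: scalemx_sub.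
have gE a b : e a b -> g 0 (enum_rank a) = g 0 (enum_rank b).
  move=> eab; have ab : a != b by apply/eqP=> h; move: eab; rewrite h adj_irrefl.
  have := congr1 (fun A : 'rV_#|E| => A 0 (enum_rank_in (edge_mem eab) [set a; b])) gM.
  rewrite !mxE; under eq_bigr => k _ do
    rewrite !mxE enum_rankK_in ?edge_mem // set2_natr // mulrDr.
  rewrite big_split /= (bigD1 (enum_rank a)) //= [X in _ + X](bigD1 (enum_rank b)) //=.
  rewrite !enum_rankK !eqxx !mulr1 !big1 ?addr0 => [/eqP||].
  - by rewrite addr_eq0 => /eqP->; apply/eqP; rewrite eq_sym -addr_eq0 addFF2.
  - by move=> k; rewrite -(inj_eq enum_val_inj) enum_rankK => /negPf->; rewrite mulr0.
  - by move=> k; rewrite -(inj_eq enum_val_inj) enum_rankK => /negPf->; rewrite mulr0.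
apply/rowP=> i; rewrite !mxE mulr1 -(enum_valK i).
case/connectP: (adj_connected a0 (enum_val i)) => p; elim: p {e0} a0 => [|x p IH] a /=.
  by move=> _ ->.
by case/andP=> eax /IH h /h ->; rewrite (gE _ _ eax).
Qed.

(* Euler's formula: the boundaries span a space of dimension at least [#|F| - 1],
   inside the cycle space, of dimension at most [#|E| - #|V| + 1 = #|F| - 1]. *)
Lemma cycle_boundary (c : 'rV['F_2]_#|E|) :
  c *m incidence_mx = 0 -> exists g, c = g *m boundary_mx.
Proof.
move=> /sub_kermxP cN; apply/submxP; apply: submx_trans cN _.
have sub : (boundary_mx <= kermx incidence_mx)%MS by apply/sub_kermxP/boundary_incidence.
rewrite -(mxrank_leqif_sup sub) eqn_leq mxrankS //= mxrank_ker.
apply: leq_trans rank_boundary; rewrite leq_subLR.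
have arith (n f m k : nat) :
  (0 < n -> 0 < f -> n.-1 <= k -> n + f = m + 2 -> m <= k + f.-1)%N by lia.
apply: arith (rank_incidence) (euler_formula G).
  by have [a _] := nonempty; apply/card_gt0P; exists a.
have [a [b eab]] := nonempty; apply/card_gt0P; exists [set d' | fconnect fn (a, b) d'].
by apply/imsetP; exists (a, b); rewrite ?inE.
Qed.

(** Modulo 2 the closed walk is a cycle, hence the boundary of a set of faces; [s a b] tells whether
    the face of the dart [(a, b)] belongs to that set. *)
Lemma closed_walk_sides (c : seq V) : path.cycle e c ->
  exists s : V -> V -> bool,
    (forall a b, e a b -> s b (r b a) = s a b) /\
    (forall a b, e a b -> s a b (+) s b a =
       odd (count (fun d => edge d == [set a; b]) (zip c (rot 1 c)))).
Proof.
move=> cyc; pose w : 'rV['F_2]_#|E| :=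
  \row_(j < #|E|) \sum_(d <- zip c (rot 1 c)) (edge d == enum_val j)%:R.
have we d : d \in zip c (rot 1 c) -> e d.1 d.2.
  case: c cyc {w} => [|x c] //=; rewrite rot1_cons; move: {1 3}x => y.
  elim: c y => [|z c IH] y /=; first by rewrite andbT inE => h /eqP->.
  by case/andP=> h1 h2; rewrite inE => /orP[/eqP->//|]; apply: IH.
have [|g wE] := @cycle_boundary w.
  apply/rowP=> k; rewrite !mxE; set v := enum_val k.
  under eq_bigr => j _ do rewrite !mxE mulr_suml.
  (* A vertex is as often the source of a step of the walk as its target. *)
  rewrite exchange_big /= (eq_big_seq (fun d => (d.1 == v)%:R + (d.2 == v)%:R)).
    rewrite big_split /=.
    rewrite -(big_map fst xpredT (fun x => (x == v)%:R)) -/(unzip1 _) unzip1_zip ?size_rot //.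
    rewrite -(big_map snd xpredT (fun x => (x == v)%:R)) -/(unzip2 _) unzip2_zip ?size_rot //.
    by rewrite (perm_big c (permEl (perm_rot 1 c))) addFF2.
  move=> d /we h.
  rewrite (@sum_enum_val_eq _ _ _ (fun f : {set V} => (v \in f)%:R)); last exact: edge_mem.
  rewrite set2_natr 1?[v == _]eq_sym 1?[v == d.2]eq_sym //.
  by apply/eqP=> E; move: h; rewrite E adj_irrefl.
exists (fun a b => dart_value g (a, b) == 1); split=> a b eab.
  by rewrite dart_value_face.
have jE := enum_rankK_in (edge_mem eab) (edge_mem eab).
have := mul_boundary g eab jE; rewrite -wE mxE jE.
have -> : \sum_(d <- zip c (rot 1 c)) (edge d == [set a; b])%:R =
   (count (fun d => edge d == [set a; b]) (zip c (rot 1 c)))%:R :> 'F_2.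
  by elim: (zip _ _) => [|d s IH]; rewrite ?big_nil ?big_cons //= IH natrD.
have F2E (x : 'F_2) : x = (x == 1)%:R.
  by apply/val_inj; case: x => [[|[|x]]].
rewrite [X in _ = X + _]F2E [X in _ = _ + X]F2E -natrD.
move: (count _ _) => n; set x := _ == 1; set y := _ == 1.
move/(congr1 val); rewrite /= !val_Fp_nat // !modn2 oddD.
by rewrite !oddb; case: (odd n); case: (_ (+) _).
Qed.

End Jordan.

(** * Isomorphisms with tubes *)

(** By the degree conditions the map sends neighbourhoods onto neighbourhoods. Hence it reflects
    adjacency, and its image is closed under adjacency, so it is everything by connectedness. *)
Lemma isomorphic_of_embedding (V W : finType) (e : rel V) (e' : rel W)
    (f : W -> V) :
  (forall v, #|neighbours e v| = 3) -> (forall v v', connect e v v') ->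
  injective f -> (forall x y, e' x y -> e (f x) (f y)) ->
  (forall x, 3 <= #|neighbours e' x|) -> 0 < #|W| -> isomorphic e e'.
Proof.
move=> deg con f_inj hom deg' /card_gt0P[w0 _].
have nbE x : neighbours e (f x) = f @: neighbours e' x.
  apply/eqP; rewrite eq_sym eqEcard deg card_imset // deg' andbT.
  by apply/subsetP=> v /imsetP[y]; rewrite !inE => h ->; apply: hom.
have homE x y : e (f x) (f y) = e' x y.
  have /setP/(_ (f y)) := nbE x; rewrite inE => ->.
  by rewrite mem_imset // inE.
have surj v : v \in codom f.
  case/connectP: (con (f w0) v) => p; elim: p w0 => [|z p IH] w /=.
    by move=> _ ->; apply: codom_f.
  case/andP=> ez ep lp; have : z \in neighbours e (f w) by rewrite inE.
  by rewrite nbE => /imsetP[w' _ E]; apply: (IH w'); rewrite -?E.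
have [|g fK gK] := inj_card_bij f_inj.
  apply: leq_trans (leq_image_card f W).
  by apply/subset_leq_card/subsetP=> v _; apply: surj.
exists g; split; first by exists f.
by move=> x y; rewrite -homE !gK.
Qed.

Lemma cycle_adjS n (i : 'I_n) : cycle_adj i (ordS i).
Proof. by rewrite /cycle_adj eqxx. Qed.

Lemma cycle_adj_pred n (i : 'I_n) : cycle_adj i (ord_pred i).
Proof.
by apply/orP; right; apply/eqP; rewrite -[X in X = _](congr1 val (ord_predK i)).
Qed.

Lemma tube_degree t (x : tube_vertex t) : 3 <= #|neighbours (@tube_adj t) x|.
Proof.
apply/card_geqP; case: x => [[]|[i j]].
- case: (boolP (odd t)) => ot.
    exists [:: inr (ord_max, inord 1); inr (ord_max, inord 3); inr (ord_max, inord 5)].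
    split=> //; last by move=> y; rewrite !inE => /or3P[] /eqP-> /=;
      rewrite /tube_adj /= eqxx inordK // ot.
    by rewrite /= !inE !negb_or /=; apply/and3P; split=> //; [apply/andP; split|];
      apply/eqP=> -[/(congr1 val)]; rewrite /= !inordK.
  exists [:: inr (ord_max, inord 0); inr (ord_max, inord 2); inr (ord_max, inord 4)].
  split=> //; last by move=> y; rewrite !inE => /or3P[] /eqP-> /=;
    rewrite /tube_adj /= eqxx inordK // (negPf ot).
  by rewrite /= !inE !negb_or /=; apply/and3P; split=> //; [apply/andP; split|];
      apply/eqP=> -[/(congr1 val)]; rewrite /= !inordK.
- exists [:: inr (ord0, inord 1); inr (ord0, inord 3); inr (ord0, inord 5)].
  split=> //; last by move=> y; rewrite !inE => /or3P[] /eqP-> /=;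
    rewrite /tube_adj /= inordK.
  by rewrite /= !inE !negb_or /=; apply/and3P; split=> //; [apply/andP; split|];
    apply/eqP=> -[/(congr1 val)]; rewrite /= !inordK.
have hor z : z \in [:: inr (i, ordS j); inr (i, ord_pred j)] ->
    tube_adj (inr (i, j) : tube_vertex t) z.
  rewrite !inE => /orP[] /eqP->; rewrite /tube_adj /= eqxx ?cycle_adjS //.
  by rewrite cycle_adj_pred.
suff [z zN za] : exists2 z : tube_vertex t, (forall k, z != inr (i, k)) &
    tube_adj (inr (i, j) : tube_vertex t) z.
  exists [:: inr (i, ordS j); inr (i, ord_pred j); z]; split=> //.
    rewrite /= !inE !negb_or ![inr (i, _) == z]eq_sym !zN !andbT.
    by apply/eqP=> -[]; case: j {zN za hor} => j lj /=; lia.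
  move=> y; rewrite [_ \in neighbours _ _]inE !in_cons orbF orbA.
  by case/orP=> [h|/eqP-> //]; apply: hor; rewrite !inE.
(* With equal parities the third edge goes up, from the last layer to [inl true]; otherwise it goes
   down, from layer 0 to [inl false]. *)
case: (boolP (odd j == odd i)) => oji.
  case: (ltngtP i t) => it.
  - have lt : i.+1 < t.+1 by [].
    exists (inr (Ordinal lt, j)).
      by move=> k; apply/eqP=> -[/(congr1 val)] /= E; lia.
    by rewrite /tube_adj /= !eqxx oji /= orbT.
  - by have := ltn_ord i; lia.
  - by exists (inl true) => //; rewrite /tube_adj /= it eqxx -it oji.
case: (posnP i) => i0.
  exists (inl false) => //; rewrite /tube_adj /= i0 /=.
  by move: oji; rewrite i0; case: (odd j).
have lt : i.-1 < t.+1 by have := ltn_ord i; lia.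
exists (inr (Ordinal lt, j)).
  by move=> k; apply/eqP=> -[/(congr1 val)] /= E; lia.
rewrite /tube_adj /= prednK // !eqxx /= orbC; apply/orP; left; apply/orP; right.
by have -> : odd j == odd i.-1 by lia.
Qed.

Lemma isomorphic_trans (U V W : finType) (e1 : rel U) (e2 : rel V) (e3 : rel W) :
  isomorphic e1 e2 -> isomorphic e2 e3 -> isomorphic e1 e3.
Proof.
move=> [f [bf fE]] [g [bg gE]]; exists (g \o f); split; first exact: bij_comp.
by move=> x y /=; rewrite gE fE.
Qed.

Lemma tube0_cube : isomorphic (@tube_adj 0) cube_adj.
Proof.
pose o (n : nat) : 'I_2 := inord n.
(* The hexagon of the cube between the opposite corners 000 and 111: odd indices have one coordinate
   equal to 1, even indices two. *)
pose g (j : nat) : 'I_2 * 'I_2 * 'I_2 :=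
  nth (o 0, o 0, o 0)
    [:: (o 1, o 0, o 1); (o 1, o 0, o 0); (o 1, o 1, o 0);
        (o 0, o 1, o 0); (o 0, o 1, o 1); (o 0, o 0, o 1)] j.
pose f (x : tube_vertex 0) : 'I_2 * 'I_2 * 'I_2 :=
  match x with
  | inl false => (o 0, o 0, o 0)
  | inl true => (o 1, o 1, o 1)
  | inr (_, j) => g j
  end.
have o01 : (o 0 == o 1) = false by apply/eqP=> /(congr1 val); rewrite /= !inordK.
have o10 : (o 1 == o 0) = false by rewrite eq_sym.
have i0 (i : 'I_1) : i = ord0 by apply/val_inj; case: i => -[].
exists f; split.
  apply: inj_card_bij; last by rewrite card_sum !card_prod !card_ord card_bool.
  move=> x y /eqP; case: x => [[]|[i [[|[|[|[|[|[|j]]]]]] //= hj]]];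
    case: y => [[]|[i' [[|[|[|[|[|[|j']]]]]] //= hj']]];
    rewrite /f /g /= !xpair_eqE ?o01 ?o10 ?eqxx //= => _;
    congr inr; rewrite (i0 i) (i0 i'); congr pair; exact/val_inj.
move=> x y; case: x => [[]|[[[|i] //= hi] [[|[|[|[|[|[|j]]]]]] //= hj]]];
    case: y => [[]|[[[|i'] //= hi'] [[|[|[|[|[|[|j']]]]]] //= hj']]];
    by rewrite /tube_adj /f /g /= /cube_adj /cartesian_adj /complete_adj /cycle_adj /=
      ?xpair_eqE ?o01 ?o10 ?eqxx.
Qed.

Lemma lt6P (Q : nat -> Prop) : Q 0 -> Q 1 -> Q 2 -> Q 3 -> Q 4 -> Q 5 ->
  forall k, k < 6 -> Q k.
Proof. by move=> ? ? ? ? ? ? [|[|[|[|[|[|k]]]]]]. Qed.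

Ltac split_uniq H :=
  rewrite /= ?inE ?negb_or ?andbT in H;
  repeat match goal with K : is_true (_ && _) |- _ => case/andP: K => ? ? end.

Ltac by_neq :=
  repeat match goal with
  | K : is_true (?x != ?y) |- context [?x == ?y] => rewrite (negPf K)
  | K : is_true (?x != ?y) |- context [?y == ?x] => rewrite (eq_sym y x) (negPf K)
  end.

(** * Rotations, faces and neighbours in a (4,6)-fullerene graph *)

Section Fullerene.

Variable G : plane_graph.
Hypothesis hG : is_46_fullerene G.
Local Notation V := (vertex G).
Local Notation e := (@adj G).
Local Notation r := (@rotation G).
Implicit Types (P : {set V}) (a b c d p q u v w x y z : V).

(** The orbit of [a] under [r v] is the whole neighbourhood, of size 3, so two values of the
    rotation determine the rest. *)
Lemma cubic_rotation v a b c : e v a -> r v a = b -> r v b = c ->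
  [/\ r v c = a, uniq [:: a; b; c] & forall x, e v x = (x \in [:: a; b; c])].
Proof.
move=> eva rb rc; have po := rotation_cyclic eva.
have c3 : #|porbit (r v) a| = 3 by rewrite po; case: hG.
have := uniq_traject_porbit (r v) a; rewrite c3 /= rb rc => u.
have := iter_porbit (r v) a; rewrite c3 /= rb rc => ra; split=> // x.
have := porbit_traject (r v) a x; rewrite c3 /= rb rc => <-.
by rewrite po inE.
Qed.

(** The boundary cycle of the face of the dart [(a, b)], reversed if it is listed against the darts,
    is rotated until it begins with [a] and [b]. *)
Lemma face_cases a b : e a b ->
  (exists c d, square a b c d) \/ (exists c d x y, hexagon a b c d x y).
Proof.
move=> eab; pose F := [set d' | fconnect (face_next r) (a, b) d'].
have FG : F \in face_set G by apply/imsetP; exists (a, b); rewrite ?inE.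
have abF : (a, b) \in F by rewrite inE connect0.
case: hG => _ /(_ F FG) /orP[] /existsP[t /and3P[ut _ Ft]] _; [left|right].
  have [c uc Fc] : exists2 c : 4.-tuple V, uniq c & F = cycle_darts c.
    case/orP: Ft => /eqP->; first by exists t.
    by exists [tuple of rev t]; rewrite //= rev_uniq.
  case/tupleP: c uc Fc => a1 /tupleP[a2 /tupleP[a3 /tupleP[a4 c]]].
  rewrite (tuple0 c) /= => u FE; have [sq _] := face_square FG u FE.
  have sq2 := square_rot sq; have sq3 := square_rot sq2; have sq4 := square_rot sq3.
  move: abF; rewrite FE !inE => /or4P[] /eqP[-> ->];
  by [exists a3, a4|exists a4, a1|exists a1, a2|exists a2, a3].
have [c uc Fc] : exists2 c : 6.-tuple V, uniq c & F = cycle_darts c.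
  case/orP: Ft => /eqP->; first by exists t.
  by exists [tuple of rev t]; rewrite //= rev_uniq.
case/tupleP: c uc Fc => a1 /tupleP[a2 /tupleP[a3 /tupleP[a4 /tupleP[a5 /tupleP[a6 c]]]]].
rewrite (tuple0 c) /= => u FE; have h1 := face_hexagon FG u FE.
have h2 := hexagon_rot h1; have h3 := hexagon_rot h2; have h4 := hexagon_rot h3.
have h5 := hexagon_rot h4; have h6 := hexagon_rot h5.
move: abF; rewrite FE !inE => /or4P[||| /or3P[]] /eqP[-> ->]; do 4!eexists; eassumption.
Qed.

Lemma adjC a b : e a b -> e b a. Proof. by rewrite adj_sym. Qed.

Lemma adj_neq a b : e a b -> a != b.
Proof. by apply: contraTneq => ->; rewrite adj_irrefl. Qed.

Lemma neighbours3 v a b c : e v a -> e v b -> e v c -> uniq [:: a; b; c] ->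
  forall x, e v x -> [\/ x = a, x = b | x = c].
Proof.
move=> ea eb ec u x ex; have N3 : #|neighbours e v| = 3 by case: hG.
have sub : [set y in [:: a; b; c]] \subset neighbours e v.
  by apply/subsetP=> y; rewrite !inE => /or3P[] /eqP->.
have := subset_leqif_cards sub => -[_].
rewrite N3 cardsE (card_uniqP u) /= eqxx => /esym/eqP E.
have : x \in [set y in [:: a; b; c]] by rewrite E inE.
by rewrite !inE => /or3P[] /eqP->; [constructor 1|constructor 2|constructor 3].
Qed.

Lemma rotation_turn v p q z : e v p -> e v q -> e v z -> uniq [:: p; q; z] ->
  r v p = q \/ r v p = z.
Proof.
move=> ep eq ez u; have [_ u' _] := cubic_rotation ep erefl erefl.
case: (neighbours3 ep eq ez u (adj_rotation (adjC ep))); [|by left|by right].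
by move=> E; move: u'; rewrite E /= inE eqxx.
Qed.

Lemma third_neighbour v a b : e v a -> e v b -> a != b ->
  exists c, e v c /\ uniq [:: a; b; c].
Proof.
move=> ea eb ab; have [_ u E] := cubic_rotation ea erefl erefl.
set b' := r v a in u E; set c' := r v b' in u E.
have eb' : e v b' by rewrite E !inE eqxx orbT.
have ec' : e v c' by rewrite E !inE eqxx !orbT.
have := eb; rewrite E !inE eq_sym (negPf ab) /= => /orP[] /eqP->.
  by exists c'.
exists b'; split=> //; move: u; rewrite /= !inE !negb_or !andbT.
by rewrite [c' == b']eq_sym => /andP[/andP[-> ->] ->].
Qed.

(** * The 4-cycles of a square-cap bound faces *)

Section Sides.

Variables (s : V -> V -> bool).
Hypothesis s_face : forall a b, e a b -> s b (r b a) = s a b.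

(** Turning around [v] amounts to reversing a dart and taking a face step; neither changes the side
    here. *)
Lemma sides_around v x y : (forall z, e v z -> s v z = s z v) ->
  e v x -> e v y -> s v x = s v y.
Proof.
move=> sv ex; have [h _ E] := cubic_rotation ex erefl erefl.
have step z : e v z -> s v (r v z) = s v z.
  by move=> ez; rewrite s_face ?(sv z) // adjC.
have e1 := adj_rotation (adjC ex).
by rewrite E !inE => /or3P[] /eqP-> //; rewrite ?step.
Qed.

End Sides.

(** Consider the two sides of the closed walk [w u1 u2 u3]. The edges leaving it at [w], [u1] and
    [u3] are joined off the walk through [u4], [u5], [u6], so they lie on one side [t]. So does the
    edge leaving at [u2], which would be a bridge otherwise. On the other side nothing leaves the
    walk, and a face follows it, in one of two directions. *)
Lemma cap_square w u1 u2 u3 u4 u5 u6 :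
  uniq [:: w; u1; u2; u3; u4; u5; u6] ->
  path.cycle e [:: u1; u2; u3; u4; u5; u6] ->
  e w u1 -> e w u3 -> e w u5 ->
  square w u1 u2 u3 \/ square w u3 u2 u1.
Proof.
move=> u cyc w1 w3 w5; move: cyc; rewrite /= andbT.
case/and5P=> e12 e23 e34 e45 /andP[e56 e61].
have cC : path.cycle e [:: w; u1; u2; u3] by rewrite /= w1 e12 e23 adjC.
have [s [s_face s_rev]] := closed_walk_sides (ex_intro _ w (ex_intro _ u1 w1)) cC.
split_uniq u.
have off a b : a \notin [:: w; u1; u2; u3] -> e a b -> s a b = s b a.
  rewrite !inE !negb_or => /and4P[? ? ? ?] eab.
  have := s_rev _ _ eab; rewrite /= !eqEsubset !subUset !sub1set !inE ?eqxx /=; by_neq.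
  by rewrite !andbF /=; case: (s a b); case: (s b a).
have on a b : e a b -> (a, b) \in [:: (w, u1); (u1, u2); (u2, u3); (u3, w)] ->
    s a b = ~~ s b a.
  move=> + h; move: h; rewrite !inE => /or4P[] /eqP[-> ->] /s_rev;
  rewrite /= !eqEsubset !subUset !sub1set !inE ?eqxx /=; by_neq;
  by rewrite ?andbF ?orbT /=; do 2!case: (s _ _).
have around v x y : v \notin [:: w; u1; u2; u3] -> e v x -> e v y -> s v x = s v y.
  by move=> vC; apply: sides_around => // z; apply: off.
set t := s w u5.
have o4 : u4 \notin [:: w; u1; u2; u3] by rewrite !inE; by_neq.
have o5 : u5 \notin [:: w; u1; u2; u3] by rewrite !inE; by_neq.
have o6 : u6 \notin [:: w; u1; u2; u3] by rewrite !inE; by_neq.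
have [e21 e32 e43] := And3 (adjC e12) (adjC e23) (adjC e34).
have [e54 e65 e16] := And3 (adjC e45) (adjC e56) (adjC e61).
have [e1w e3w e5w] := And3 (adjC w1) (adjC w3) (adjC w5).
have t5 : s u5 w = t by apply: off.
have t3 : s u3 u4 = t.
  by rewrite -(off u4 u3) // (around u4 u3 u5) // (off u4 u5) // (around u5 u4 w).
have t1 : s u1 u6 = t.
  by rewrite -(off u6 u1) // (around u6 u1 u5) // (off u6 u5) // (around u5 u6 w).
have [x [e2x ux]] := third_neighbour e21 e23 ltac:(by []).
split_uniq ux.
have x2 := adj_neq e2x.
have Nw := neighbours3 w1 w3 w5 ltac:(by rewrite /= !inE; by_neq).
have N1 := neighbours3 e1w e12 e16 ltac:(by rewrite /= !inE; by_neq).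
have N3 := neighbours3 e3w e32 e34 ltac:(by rewrite /= !inE; by_neq).
have N2 := neighbours3 e21 e23 e2x ltac:(by rewrite /= !inE; by_neq).
have xw : x != w.
  by apply/eqP=> E; have := adjC e2x; rewrite E => /Nw[] /eqP; by_neq.
have xC : x \notin [:: w; u1; u2; u3] by rewrite !inE; by_neq.
have tx : s u2 x = t.
  (* Otherwise [u2 x] is the only edge entering the side [~~ t], a bridge, and the
     face containing the dart [(u2, x)] would contain [(x, u2)] as well. *)
  apply/eqP; apply/negPn/negP=> sx.
  have {}sx : s u2 x = ~~ t by move: sx; case: (s u2 x); case: (t).
  (* [T] holds of the vertices that lie strictly on the side [~~ t]. As the edges leaving the walk
     at [w], [u1], [u3] are on the side [t], the only edge out of [T] is [x u2]. *)
  pose T b := b \notin [:: w; u1; u2; u3] /\ forall c, e b c -> s b c = ~~ t.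
  have Tx : T x by split=> // c ec; rewrite (around x c u2) ?(off x u2) // adjC.
  have step b c : e b c -> T b -> T c \/ c = u2 /\ b = x.
    move=> ebc [bC sb]; have sc : s c b = ~~ t by rewrite -off // sb.
    case: (boolP (c \in [:: w; u1; u2; u3])) => [|cC']; last first.
      by left; split=> // d ed; rewrite (around c d b) // adjC.
    move: bC; rewrite !inE !negb_or => /and4P[? ? ? ?].
    case/or4P=> /eqP E; move: sc (adjC ebc); rewrite {}E.
    - by move=> sc /Nw[] E; [move/eqP: E; by_neq|move/eqP: E; by_neq|
        move: sc; rewrite E -/t; case: (t)].
    - by move=> sc /N1[] E; [move/eqP: E; by_neq|move/eqP: E; by_neq|
        move: sc; rewrite E t1; case: (t)].
    - by move=> sc /N2[] E; [move/eqP: E; by_neq|move/eqP: E; by_neq|right].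
    - by move=> sc /N3[] E; [move/eqP: E; by_neq|move/eqP: E; by_neq|
        move: sc; rewrite E t3; case: (t)].
  have Tu2 : ~ T u2 by case; rewrite !inE eqxx !orbT.
  have next b c : e b c -> T b -> c != u2 -> T c.
    by move=> ebc Tb cu; case: (step _ _ ebc Tb) => // -[E]; rewrite E eqxx in cu.
  have back b : e b u2 -> T b -> b = x.
    by move=> eb Tb; case: (step _ _ eb Tb) => // -[].
  (* Followed beyond [x], this face stays in [T] until it returns to [u2], which is possible only
     from [x]; but its vertices are distinct. *)
  case: (face_cases e2x) => [[c [d [u ra rb rc rd]]]|].
    split_uniq u; have exc : e x c by rewrite -ra; apply: adj_rotation.
    have ecd : e c d by rewrite -rb; apply: adj_rotation.
    have ed2 : e d u2 by rewrite -rc; apply: adj_rotation.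
    have Tc : T c by apply: next exc Tx _; rewrite eq_sym.
    have Td : T d by apply: next ecd Tc _; rewrite eq_sym.
    by have /eqP := back _ ed2 Td; by_neq.
  case=> c [d [f [g [u [ra rb rc] [rd re rf]]]]]; split_uniq u.
  have exc : e x c by rewrite -ra; apply: adj_rotation.
  have ecd : e c d by rewrite -rb; apply: adj_rotation.
  have edf : e d f by rewrite -rc; apply: adj_rotation.
  have efg : e f g by rewrite -rd; apply: adj_rotation.
  have eg2 : e g u2 by rewrite -re; apply: adj_rotation.
  have Tc : T c by apply: next exc Tx _; rewrite eq_sym.
  have Td : T d by apply: next ecd Tc _; rewrite eq_sym.
  have Tf : T f by apply: next edf Td _; rewrite eq_sym.
  have Tg : T g by apply: next efg Tf _; rewrite eq_sym.
  by have /eqP := back _ eg2 Tg; by_neq.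
(* A face arriving on the side [~~ t] cannot leave along an edge on the side [t]. *)
have turn v p q z : e v p -> e v q -> e v z -> uniq [:: p; q; z] ->
    s v z = t -> s p v = ~~ t -> r v p = q.
  move=> ep eq ez uv sz sp; case: (rotation_turn ep eq ez uv) => // E.
  by have := s_face _ _ (adjC ep); rewrite E sz sp; case: (t).
(* The direction of the face depends on which of the two darts of the edge [w u1] is on the side
   [~~ t]. *)
case: (boolP (s w u1 == t)) => /eqP s1.
  have s1w : s u1 w = ~~ t.
    have := on w u1 w1 ltac:(by rewrite !inE eqxx).
    by rewrite s1; case: (s u1 w); case: (t).
  have r1 : r w u1 = u3 by apply: (turn _ _ _ u5) => //; rewrite /= !inE; by_neq.
  have s3 : s w u3 = ~~ t by rewrite -r1 s_face.
  have r2 : r u3 w = u2 by apply: (turn _ _ _ u4) => //; rewrite /= !inE; by_neq.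
  have s2 : s u3 u2 = ~~ t by rewrite -r2 s_face.
  have r3 : r u2 u3 = u1 by apply: (turn _ _ _ x) => //; rewrite /= !inE; by_neq.
  have s21 : s u2 u1 = ~~ t by rewrite -r3 s_face.
  have r4 : r u1 u2 = w by apply: (turn _ _ _ u6) => //; rewrite /= !inE; by_neq.
  by right; split=> //; rewrite /= !inE; by_neq.
have sw1 : s w u1 = ~~ t by move: s1; case: (s w u1); case: (t).
have r1 : r u1 w = u2 by apply: (turn _ _ _ u6) => //; rewrite /= !inE; by_neq.
have s12 : s u1 u2 = ~~ t by rewrite -r1 s_face.
have r2 : r u2 u1 = u3 by apply: (turn _ _ _ x) => //; rewrite /= !inE; by_neq.
have s23 : s u2 u3 = ~~ t by rewrite -r2 s_face.
have r3 : r u3 u2 = w by apply: (turn _ _ _ u4) => //; rewrite /= !inE; by_neq.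
have s3w : s u3 w = ~~ t by rewrite -r3 s_face.
have r4 : r w u3 = u1 by apply: (turn _ _ _ u5) => //; rewrite /= !inE; by_neq.
by left; split=> //; rewrite /= !inE; by_neq.
Qed.

(** * Growing a square-cap *)

(* [u0 .. u5] bounds a patch; the outer faces run along it in this order. [P] is
   the set of the patch vertices all of whose edges lie in the patch, and [u0],
   [u2], [u4] are the others, each with one edge leaving the patch. *)
Record ring6 P u0 u1 u2 u3 u4 u5 : Prop := Ring6 {
  ring6_uniq : uniq [:: u0; u1; u2; u3; u4; u5];
  ring6_cycle : path.cycle e [:: u0; u1; u2; u3; u4; u5];
  ring6_in : [/\ u1 \in P, u3 \in P & u5 \in P];
  ring6_notin : [/\ u0 \notin P, u2 \notin P & u4 \notin P];
  ring6_closed : forall p q, p \in P -> e p q ->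
    (q \in P) || (q \in [:: u0; u2; u4]);
  ring6_straight : [/\ r u1 u0 = u2, r u3 u2 = u4 & r u5 u4 = u0];
  ring6_corner : [/\ r u0 u1 = u5, r u2 u3 = u1 & r u4 u5 = u3];
  ring6_out : [/\ r u0 u5 \notin P, r u2 u1 \notin P & r u4 u3 \notin P]
}.

Lemma ring6_rot P u0 u1 u2 u3 u4 u5 :
  ring6 P u0 u1 u2 u3 u4 u5 -> ring6 P u2 u3 u4 u5 u0 u1.
Proof.
case=> u cy [i1 i3 i5] [n0 n2 n4] cl [s1 s3 s5] [c0 c2 c4] [o0 o2 o4]; split=> //.
- by rewrite -(rot_uniq 4).
- by rewrite -(rot_cycle 4).
- move=> p q pP /(cl _ _ pP); rewrite !inE.
  by case: (q == u0); case: (q == u2); case: (q == u4); rewrite ?orbT ?orbF.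
Qed.

(** The face of the dart [(u0, u1)] goes straight at [u1], leaves the patch at [u2] and comes back
    along the edge going out of [u0]. *)
Lemma ring6_face P u0 u1 u2 u3 u4 u5 : ring6 P u0 u1 u2 u3 u4 u5 ->
  (r u0 u5 = r u2 u1 /\ r (r u2 u1) u2 = u0) \/
  exists y, hexagon u0 u1 u2 (r u2 u1) y (r u0 u5).
Proof.
case=> u cy _ _ _ [s1 s3 s5] [c0 c2 c4] _.
have e01 : e u0 u1 by case/andP: cy.
have [c5 _ _] := cubic_rotation e01 c0 erefl.
case: (face_cases e01) => [[c [d [uq r1 r2 r3 r4]]]|].
  have E : d = r u2 u1 by rewrite -r2 -r1 s1.
  left; rewrite -E -{1}s1 r1 r3; split=> //.
  by apply: (@perm_inj _ (r u0)); rewrite c5 r4.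
case=> c [d [x [y [uq [r1 r2 r3] [r4 r5 r6]]]]].
right; exists x; have E : y = r u0 u5 by apply: (@perm_inj _ (r u0)); rewrite c5 r6.
by rewrite -E -s1 r1 r2.
Qed.

(** Let [x] be the common outer neighbour of [u0] and [u2]. If the two other faces were hexagons,
    both would contain the third neighbour of [x], where the rotation would exchange [x] and [x4];
    but it is a 3-cycle. *)
Lemma ring6_squares P u0 u1 u2 u3 u4 u5 : ring6 P u0 u1 u2 u3 u4 u5 ->
  r u0 u5 = r u2 u1 -> r (r u2 u1) u2 = u0 -> r u4 u3 = r u2 u1.
Proof.
move=> R E sq; case: (ring6_face (ring6_rot R)) => [[-> //]|].
case: (ring6_face (ring6_rot (ring6_rot R))) => [[-> _ //]|].
case=> y5 [_ [_ _ h51] [h52 h53 h54]] [y3 [_ [_ _ h31] [h32 h33 h34]]].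
have [_ cy _ _ _ _ _ _] := R.
rewrite E in h51 h52; set x := r u2 u1 in E h51 h52 h32 h33 sq.
set x4 := r u4 u3 in h52 h53 h54 h31 h32.
have e2x : e u2 x by apply: adj_rotation; case/and3P: cy.
have [k _ _] := cubic_rotation (adjC e2x) sq h51.
have E35 : y3 = y5 by apply: (@perm_inj _ (r x)); rewrite k h33.
have ey5 : e y5 x by apply/adjC; rewrite -h51; apply: adj_rotation;
  apply/adjC; rewrite -sq; apply: adj_rotation.
rewrite E35 in h32.
have [k' + _] := cubic_rotation ey5 h52 h32.
by rewrite /= !inE eqxx orbT.
Qed.

(** Three hexagons around the patch: [x0], [x2], [x4] end the outgoing edges, and
    [y1 x2 y3 x4 y5 x0] is to be the next boundary. *)
Record hexes P u0 u1 u2 u3 u4 u5 x0 y1 x2 y3 x4 y5 : Prop := Hexes {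
  hexes_ring : ring6 P u0 u1 u2 u3 u4 u5;
  hexes_out : [/\ x0 = r u0 u5, x2 = r u2 u1 & x4 = r u4 u3];
  hexes1 : hexagon u0 u1 u2 x2 y1 x0;
  hexes3 : hexagon u2 u3 u4 x4 y3 x2;
  hexes5 : hexagon u4 u5 u0 x0 y5 x4
}.

Lemma hexes_rot P u0 u1 u2 u3 u4 u5 x0 y1 x2 y3 x4 y5 :
  hexes P u0 u1 u2 u3 u4 u5 x0 y1 x2 y3 x4 y5 ->
  hexes P u2 u3 u4 u5 u0 u1 x2 y3 x4 y5 x0 y1.
Proof. by case=> R [o0 o2 o4] h1 h3 h5; split=> //; apply: ring6_rot. Qed.

Lemma ring6_cases P u0 u1 u2 u3 u4 u5 : ring6 P u0 u1 u2 u3 u4 u5 ->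
  (r u0 u5 = r u2 u1 /\ r u4 u3 = r u2 u1) \/
  exists x0 y1 x2 y3 x4 y5, hexes P u0 u1 u2 u3 u4 u5 x0 y1 x2 y3 x4 y5.
Proof.
move=> R; have R2 := ring6_rot R; have R4 := ring6_rot R2.
case: (ring6_face R) => [[E1 E2]|[y1 h1]].
  by left; rewrite (ring6_squares R E1 E2).
case: (ring6_face R2) => [[E1 E2]|[y3 h3]].
  by left; rewrite (ring6_squares R2 E1 E2) E1.
case: (ring6_face R4) => [[E1 E2]|[y5 h5]].
  by left; rewrite (ring6_squares R4 E1 E2) E1.
right; exists (r u0 u5), y1, (r u2 u1), y3, (r u4 u3), y5; by split.
Qed.

Lemma ring6_adj P u0 u1 u2 u3 u4 u5 : ring6 P u0 u1 u2 u3 u4 u5 ->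
  [/\ e u0 u1, e u2 u3 & e u4 u5].
Proof. by case=> _ /and5P[-> _ -> _ /andP[->]]. Qed.

(** A third of the facts about the new layer; [hexes_rot] yields the others by symmetry. *)
Lemma hexes_local P u0 u1 u2 u3 u4 u5 x0 y1 x2 y3 x4 y5 :
  hexes P u0 u1 u2 u3 u4 u5 x0 y1 x2 y3 x4 y5 ->
  [/\ [/\ e u0 x0, e y1 x0, e y1 x2, r x2 y1 = y3 & r y1 x2 = x0],
      forall z, e u0 z = (z \in [:: u1; u5; x0]),
      forall z, e x2 z = (z \in [:: u2; y1; y3]),
      forall z, e y1 z = (z \in [:: x2; x0; r y1 x0]) &
      [/\ uniq [:: x2; x0; r y1 x0], y1 != y3,
          x0 \notin P /\ x0 \notin [:: u0; u2; u4; x2; x4],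
          y1 \notin P & y1 \notin [:: u0; u2; u4; x0; x2; x4]]].
Proof.
case=> R [o0 o2 o4] [q1 [_ _ a3] [a4 a5 a6]] [q3 [_ _ b3] [b4 b5 b6]].
case=> [q5 [_ _ c3] [c4 c5 c6]].
have [u cy [i1 i3 i5] [n0 n2 n4] cl [s1 s3 s5] [d0 d2 d4] [t0 t2 t4]] := R.
have [e01 e23 e45] := ring6_adj R.
have [_ un0 N0] := cubic_rotation e01 d0 (esym o0).
have [_ un4 N4] := cubic_rotation e45 d4 (esym o4).
have [_ un2 N2] := cubic_rotation e23 d2 (esym o2).
have e2x : e u2 x2 by rewrite N2 !inE eqxx !orbT.
have e4x : e u4 x4 by rewrite N4 !inE eqxx !orbT.
have e0x : e u0 x0 by rewrite N0 !inE eqxx !orbT.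
have [k2 unx2 Nx2] := cubic_rotation (adjC e2x) a3 erefl.
have Ey3 : r x2 y1 = y3 by apply: (@perm_inj _ (r x2)); rewrite k2 b5.
rewrite Ey3 in unx2 Nx2 k2.
have [k4 unx4 Nx4] := cubic_rotation (adjC e4x) b3 erefl.
have Ey5 : r x4 y3 = y5 by apply: (@perm_inj _ (r x4)); rewrite k4 c5.
rewrite Ey5 in unx4 Nx4 k4.
have ey1 : e y1 x2 by apply: adjC; rewrite Nx2 !inE eqxx orbT.
have [_ uny Ny] := cubic_rotation ey1 a4 erefl.
have ey0 : e y1 x0 by rewrite Ny !inE eqxx orbT.
have x0P : x0 \notin P by rewrite o0.
rewrite -o2 -o4 in t2 t4.
split_uniq q1; split_uniq q3; split_uniq q5; split_uniq unx2; split_uniq u.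
have x0u : x0 \notin [:: u0; u2; u4; x2; x4] by rewrite !inE; by_neq.
have y1P : y1 \notin P.
  by apply/negP=> /cl/(_ ey0); rewrite (negPf x0P) !inE; by_neq.
split=> //; split=> //.
have y1u4 : y1 != u4.
  apply/eqP=> E; have := ey0; rewrite E N4 !inE; by_neq; rewrite ?orbF /= => /eqP h.
  by rewrite h i3 in x0P.
(* Otherwise [x0] is [y3], and the rotation at [x4] sends both [u4] and [x2] to it. *)
have y1x4 : y1 != x4.
  apply/eqP=> E; have := ey0; rewrite E Nx4 !inE; by_neq; rewrite ?orbF /= => /eqP h.
  have : r x4 u4 = r x4 x2 by rewrite b3 -E a4 h.
  by move/perm_inj/eqP; by_neq.
by rewrite !inE; by_neq.
Qed.

(** With squares outside, the three outgoing edges meet at [b]. With hexagons, the old corners and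
    the [x] vertices become interior, and [y1], [y3], [y5] are the new corners. *)
Lemma ring6_step P u0 u1 u2 u3 u4 u5 : ring6 P u0 u1 u2 u3 u4 u5 ->
  (exists b, [/\ b \notin P, b \notin [:: u0; u2; u4], e u0 b, e u2 b & e u4 b]) \/
  exists x0 y1 x2 y3 x4 y5,
    [/\ ring6 (P :|: [set x in [:: u0; u2; u4; x0; x2; x4]]) y1 x2 y3 x4 y5 x0,
        all (fun z => (z \notin P) && (z \notin [:: u0; u2; u4]))
          [:: y1; x2; y3; x4; y5; x0]
      & [/\ e u0 x0, e u2 x2 & e u4 x4]].
Proof.
move=> R; have [u cy [i1 i3 i5] [n0 n2 n4] cl [s1 s3 s5] [d0 d2 d4] [t0 t2 t4]] := R.
have [e01 e23 e45] := ring6_adj R.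
case: (ring6_cases R) => [[E1 E2]|].
  have eb0 : e u0 (r u0 u5).
    by have [_ _ ->] := cubic_rotation e01 d0 erefl; rewrite !inE eqxx !orbT.
  have eb2 : e u2 (r u2 u1).
    by have [_ _ ->] := cubic_rotation e23 d2 erefl; rewrite !inE eqxx !orbT.
  have eb4 : e u4 (r u4 u3).
    by have [_ _ ->] := cubic_rotation e45 d4 erefl; rewrite !inE eqxx !orbT.
  rewrite E1 in eb0; rewrite E2 in eb4; left; exists (r u2 u1); split=> //.
  by rewrite !inE !negb_or !(eq_sym (r u2 u1)) !adj_neq.
case=> x0 [y1 [x2 [y3 [x4 [y5 H]]]]]; right; exists x0, y1, x2, y3, x4, y5.
have [[ea1 eb1 ec1 f1 g1] Nu0 Nx2 Ny1 [v1 w1 [p1 q1] m1 l1]] := hexes_local H.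
have [[ea3 eb3 ec3 f3 g3] Nu2 Nx4 Ny3 [v3 w3 [p3 q3] m3 l3]] := hexes_local (hexes_rot H).
have [[ea5 eb5 ec5 f5 g5] Nu4 Nx0 Ny5 [v5 w5 [p5 q5] m5 l5]] :=
  hexes_local (hexes_rot (hexes_rot H)).
split_uniq u; split_uniq q1; split_uniq q3; split_uniq q5.
split_uniq l1; split_uniq l3; split_uniq l5; split_uniq v1; split_uniq v3; split_uniq v5.
have yP y : y \in [:: y1; y3; y5] ->
    (y \notin P) && (y \notin [:: u0; u2; u4; x0; x2; x4]).
  by rewrite !inE => /or3P[] /eqP->; rewrite ?m1 ?m3 ?m5 /=; by_neq.
have outN y z : y \in [:: y1; y3; y5] -> e y z ->
    (z \notin P) && (z \notin [:: u0; u2; u4]).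
  move=> yy /adjC ezy; have := yP _ yy; rewrite !inE !negb_or.
  case/and5P=> yNP yu0 yu2 yu4 /and3P[yx0 yx2 yx4].
  apply/andP; split.
    by apply/negP=> zP; have := cl _ _ zP ezy; rewrite (negPf yNP) !inE; by_neq.
  rewrite -!negb_or; apply/negP=> /or3P[] /eqP E; move: ezy;
  rewrite E ?Nu0 ?Nu2 ?Nu4 !inE; by_neq;
  by rewrite orbF => /orP[] /eqP Ey; rewrite Ey ?i1 ?i3 ?i5 in yNP.
split; last by split.
  split.
  - by rewrite /= !inE; by_neq.
  - by rewrite /= ec1 (adjC eb3) ec3 (adjC eb5) ec5 (adjC eb1).
  - by rewrite !inE !eqxx !orbT.
  - by rewrite !inE; by_neq; rewrite (negPf m1) (negPf m3) (negPf m5).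
  - move=> p q; rewrite in_setU => /orP[pP epq|].
      by have := cl _ _ pP epq; rewrite !inE => /orP[->//|/or3P[] ->]; rewrite ?orbT.
    rewrite inE !in_cons orbF => /or4P[|||/or3P[]] /eqP->;
    by rewrite ?Nu0 ?Nu2 ?Nu4 ?Nx0 ?Nx2 ?Nx4 !inE => /or3P[] /eqP->;
      rewrite ?eqxx ?i1 ?i3 ?i5 ?orbT.
  - by [].
  - by [].
  - have ny y z : e y z -> y \in [:: y1; y3; y5] -> z != x0 -> z != x2 -> z != x4 ->
       z \notin P :|: [set x in [:: u0; u2; u4; x0; x2; x4]].
      move=> eyz yy k0 k2 k4; have := outN _ _ yy eyz; rewrite !inE !negb_or.
      by rewrite k0 k2 k4 !andbT => /and4P[-> -> -> ->].
    have z1 : e y1 (r y1 x0) by rewrite Ny1 !inE eqxx !orbT.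
    have z3 : e y3 (r y3 x2) by rewrite Ny3 !inE eqxx !orbT.
    have z5 : e y5 (r y5 x4) by rewrite Ny5 !inE eqxx !orbT.
    split.
    + apply: (ny y1) => //; rewrite ?inE ?eqxx //; by_neq => //.
      by apply/eqP=> E; have := adjC z1; rewrite E Nx4 !inE; by_neq.
    + apply: (ny y3) => //; rewrite ?inE ?eqxx ?orbT //; by_neq => //.
      by apply/eqP=> E; have := adjC z3; rewrite E Nx0 !inE; by_neq.
    + apply: (ny y5) => //; rewrite ?inE ?eqxx ?orbT //; by_neq => //.
      by apply/eqP=> E; have := adjC z5; rewrite E Nx2 !inE; by_neq.
by rewrite /= !inE p1 p3 p5 m1 m3 m5; by_neq.
Qed.

(** The three 4-cycles through the centre bound squares, whose directions agree because they share
    the rotation at the centre. *)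
Lemma cap_ring : has_square_cap G ->
  exists a u0 u1 u2 u3 u4 u5,
    [/\ ring6 [set x in [:: a; u1; u3; u5]] u0 u1 u2 u3 u4 u5,
        uniq [:: a; u0; u1; u2; u3; u4; u5],
        e a u1, e a u3 & e a u5].
Proof.
move=> [u1 [u2 [u3 [u4 [u5 [u6 [w [u cy [w1 w3 w5]]]]]]]]].
wlog sq : u1 u2 u3 u4 u5 u6 u cy w1 w3 w5 / square w u1 u2 u3.
  move=> H; have [sq|sq] := cap_square u cy w1 w3 w5.
    by apply: (H u1 u2 u3 u4 u5 u6).
  have u' := u; split_uniq u'; apply: (H u3 u2 u1 u6 u5 u4) => //.
    by rewrite /= !inE; by_neq.
  move: cy; rewrite /= !andbT => /and5P[e12 e23 e34 e45 /andP[e56 e61]].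
  by apply/and5P; split; [| | | |apply/andP; split]; apply: adjC.
have u' := u; split_uniq u'.
have cy2 : path.cycle e [:: u3; u4; u5; u6; u1; u2] by rewrite -(rot_cycle 4).
have cy3 : path.cycle e [:: u5; u6; u1; u2; u3; u4] by rewrite -(rot_cycle 2).
have uq2 : uniq [:: w; u3; u4; u5; u6; u1; u2] by rewrite /= !inE; by_neq.
have uq3 : uniq [:: w; u5; u6; u1; u2; u3; u4] by rewrite /= !inE; by_neq.
move: cy; rewrite /= andbT => /and5P[e12 e23 e34 e45 /andP[e56 e61]].
have [_ a1 a2 a3 a4] := sq.
have Nw := neighbours3 w1 w3 w5 ltac:(by rewrite /= !inE; by_neq).
have N1 := neighbours3 (adjC w1) e12 (adjC e61) ltac:(by rewrite /= !inE; by_neq).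
have N3 := neighbours3 (adjC w3) (adjC e23) e34 ltac:(by rewrite /= !inE; by_neq).
have N5 := neighbours3 (adjC w5) (adjC e45) e56 ltac:(by rewrite /= !inE; by_neq).
have [k1 + _] := cubic_rotation w3 a4 erefl => uw.
have rw1 : r w u1 = u5.
  have := adj_rotation (adjC w1) => /Nw[] // E;
  by move: uw; rewrite E /= !inE !eqxx ?orbT ?andbF.
rewrite rw1 in k1.
(* The opposite direction would give [r w u3 = u5], whereas the first square gives [u1]. *)
have [_ b1 b2 b3 b4] : square w u3 u4 u5.
  have [//|[_ _ _ _]] := cap_square uq2 cy2 w3 w5 w1.
  by rewrite a4 => /eqP; by_neq.
have [_ c1 c2 c3 c4] : square w u5 u6 u1.
  have [//|[_ _ _ _]] := cap_square uq3 cy3 w5 w1 w3.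
  by rewrite b4 => /eqP; by_neq.
have [s1 _ _] := cubic_rotation (adjC e61) c3 a1.
have [s3 _ _] := cubic_rotation (adjC e23) a3 b1.
have [s5 _ _] := cubic_rotation (adjC e45) b3 c1.
have [_ t2 M2] := cubic_rotation (adjC e12) a2 erefl.
have [_ t4 M4] := cubic_rotation (adjC e34) b2 erefl.
have [_ t6 M6] := cubic_rotation (adjC e56) c2 erefl.
split_uniq t2; split_uniq t4; split_uniq t6.
have f2 : e u2 (r u2 u3) by rewrite M2 !inE eqxx !orbT.
have f4 : e u4 (r u4 u5) by rewrite M4 !inE eqxx !orbT.
have f6 : e u6 (r u6 u1) by rewrite M6 !inE eqxx !orbT.
(* The squares run along the 6-cycle in increasing order, so the outer faces run along it backwards;
   [u2], [u6], [u4] are the corners. *)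
exists w, u2, u1, u6, u5, u4, u3; split=> //; last by rewrite /= !inE; by_neq.
split=> //.
- by rewrite /= !inE; by_neq.
- by rewrite /= andbT; apply/and5P; split; [| | | |apply/andP; split]; apply: adjC.
- by rewrite !inE !eqxx !orbT.
- by rewrite !inE; by_neq.
- move=> p q; rewrite inE !in_cons orbF => /or4P[] /eqP->.
  + by case/Nw=> ->; rewrite !inE !eqxx ?orbT.
  + by case/N1=> ->; rewrite !inE !eqxx ?orbT.
  + by case/N5=> ->; rewrite !inE !eqxx ?orbT.
  + by case/N3=> ->; rewrite !inE !eqxx ?orbT.
- rewrite !inE; by_neq.
  split; apply/negP; rewrite ?orbF /=.
  + case/orP=> /eqP E; move: (adjC f2); rewrite E;
    first [by case/Nw=> /eqP; by_neq|by case/N5=> /eqP; by_neq].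
  + case/orP=> /eqP E; move: (adjC f6); rewrite E;
    first [by case/Nw=> /eqP; by_neq|by case/N3=> /eqP; by_neq].
  + case/orP=> /eqP E; move: (adjC f4); rewrite E;
    first [by case/Nw=> /eqP; by_neq|by case/N1=> /eqP; by_neq].
Qed.

(* [u i k] is the paper's [c_{i, k + i}], so that the vertices of layer [i]
   joined to layer [i + 1] are those with [k] even. *)
Record partial_tube t a (u : nat -> nat -> V) P : Prop := PartialTube {
  pt_ring : ring6 P (u t 0) (u t 1) (u t 2) (u t 3) (u t 4) (u t 5);
  pt_apex_in : a \in P;
  pt_apex : forall i k, i <= t -> k < 6 -> u i k != a;
  pt_inj : forall i k i' k', i <= t -> k < 6 -> i' <= t -> k' < 6 ->
    u i k = u i' k' -> i = i' /\ k = k';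
  pt_mem : forall i k, i <= t -> k < 6 ->
    (u i k \in P) || (u i k \in [:: u t 0; u t 2; u t 4]);
  pt_apex_adj : [/\ e a (u 0 1), e a (u 0 3) & e a (u 0 5)];
  pt_layer : forall i k, i <= t -> k < 6 -> e (u i k) (u i (k.+1 %% 6));
  pt_spoke : forall i k, i < t -> k < 6 -> ~~ odd k ->
    e (u i k) (u i.+1 ((k + 5) %% 6))
}.

(** With [b] as second apex the layers embed the tube, and an embedding into a connected cubic graph
    is an isomorphism. *)
Lemma partial_tube_cap t a (u : nat -> nat -> V) P b : partial_tube t a u P ->
  b \notin P -> b \notin [:: u t 0; u t 2; u t 4] ->
  e (u t 0) b -> e (u t 2) b -> e (u t 4) b -> isomorphic e (@tube_adj t).
Proof.
case=> _ aP apex inj mem [a1 a3 a5] layer spoke bP bN b0 b2 b4.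
(* [j + 5 * i] is [j - i] modulo 6, as [u i k] stands for [c_{i, k + i}]. *)
pose f (x : tube_vertex t) := match x with
  | inl false => a
  | inl true => b
  | inr (i, j) => u i ((j + 5 * i) %% 6)
  end.
have lt6 n : n %% 6 < 6 by rewrite ltn_mod.
have bu i k : i <= t -> k < 6 -> u i k != b.
  move=> it k6; apply/eqP=> E; have := mem i k it k6.
  by rewrite E (negPf bP) (negPf bN).
have ba : b != a by apply: contraNneq bP => ->.
apply: (@isomorphic_of_embedding _ _ _ _ f).
- by case: hG.
- exact: adj_connected.
- move=> [[]|[i j]] [[]|[i' j']] //= E.
  + by rewrite E eqxx in ba.
  + by have := bu _ _ (ltn_ord i' : i' <= t) (lt6 (j' + 5 * i')); rewrite -E eqxx.
  + by rewrite -E eqxx in ba.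
  + by have := apex _ _ (ltn_ord i' : i' <= t) (lt6 (j' + 5 * i')); rewrite -E eqxx.
  + by have := bu _ _ (ltn_ord i : i <= t) (lt6 (j + 5 * i)); rewrite E eqxx.
  + by have := apex _ _ (ltn_ord i : i <= t) (lt6 (j + 5 * i)); rewrite E eqxx.
  + have [] := inj _ _ _ _ (ltn_ord i : i <= t) (lt6 _) (ltn_ord i' : i' <= t) (lt6 _) E.
    move=> Ei; rewrite Ei => Ej; congr (inr (_, _)); apply/val_inj => //=.
    by have := ltn_ord j; have := ltn_ord j'; lia.
- have arc (x y : tube_vertex t) : tube_arc x y -> e (f x) (f y).
    case: x y => [[]|[i j]] [[]|[i' j']] //=.
    + move=> /andP[/eqP-> oj]; rewrite muln0 addn0 modn_small //.
      by move: (nat_of_ord j') (ltn_ord j') oj; apply: lt6P.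
    + move=> /andP[/eqP-> oj].
      have : ~~ odd ((j + 5 * t) %% 6) by lia.
      by move: (_ %% 6) (lt6 (j + 5 * t)); apply: lt6P.
    + case/orP=> [/andP[/eqP<-]|/and3P[/eqP Ei /eqP<- oj]].
        case/orP=> /eqP->.
          have -> : (j.+1 %% 6 + 5 * i) %% 6 = ((j + 5 * i) %% 6).+1 %% 6 by lia.
          exact: layer (ltn_ord i) (lt6 _).
        have -> : (j'.+1 %% 6 + 5 * i) %% 6 = ((j' + 5 * i) %% 6).+1 %% 6 by lia.
        apply: adjC; exact: layer (ltn_ord i) (lt6 _).
      have it : i < t by have := ltn_ord i'; rewrite Ei.
      have -> : (j + 5 * i') %% 6 = ((j + 5 * i) %% 6 + 5) %% 6 by lia.
      by rewrite Ei; apply: spoke => //; lia.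
  by move=> x y /orP[/arc//|/arc/adjC].
- exact: tube_degree.
- by apply/card_gt0P; exists (inl true).
Qed.

(** Both outcomes come from [ring6_step]; the growth of [P] is the measure that makes the iteration
    end. *)
Lemma partial_tube_grow t a (u : nat -> nat -> V) P : partial_tube t a u P ->
  isomorphic e (@tube_adj t) \/
  exists (u' : nat -> nat -> V) P', partial_tube t.+1 a u' P' /\ #|P| < #|P'|.
Proof.
move=> T; have [R aP apex inj mem aa layer spoke] := T.
case: (ring6_step R) => [[b [bP bN b0 b2 b4]]|].
  by left; apply: partial_tube_cap T bP bN b0 b2 b4.
case=> x0 [y1 [x2 [y3 [x4 [y5 [R' al [e0 e2 e4]]]]]]]; right.
(* The list begins at [y1] because spokes lead from index [k] to [k - 1] modulo 6: [x0], joined to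
   [u t 0], gets index 5. *)
pose s := [:: y1; x2; y3; x4; y5; x0].
pose u' i k := if i == t.+1 then nth a s k else u i k.
have uS k : u' t.+1 k = nth a s k by rewrite /u' eqxx.
have uE i k : i <= t -> u' i k = u i k by rewrite /u'; case: eqP => // ->; rewrite ltnn.
have news z : z \in s -> (z \notin P) && (z \notin [:: u t 0; u t 2; u t 4]).
  by move=> zs; have /allP/(_ z zs) := al.
have newk k : k < 6 -> nth a s k \in s by move=> k6; apply: mem_nth.
have newN i k k' : i <= t -> k < 6 -> k' < 6 -> (u i k == nth a s k') = false.
  move=> it k6 k6'; apply/eqP=> E; have := mem i k it k6.
  by have /andP[h1 h2] := news _ (newk _ k6'); rewrite E (negPf h1) (negPf h2).
have [us cys _ [n0 _ _] _ _ _ _] := R'.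
exists u', (P :|: [set x in [:: u t 0; u t 2; u t 4; x0; x2; x4]]); split.
  split.
  - by rewrite !uS.
  - by rewrite inE aP.
  - move=> i k; rewrite leq_eqVlt => /orP[/eqP-> k6|it k6]; last by rewrite uE // apex.
    rewrite uS; apply/eqP=> E; have /andP[] := news _ (newk _ k6).
    by rewrite E aP.
  - move=> i k i' k'; rewrite leq_eqVlt => /orP[/eqP->|it] k6;
      rewrite leq_eqVlt => /orP[/eqP->|it'] k6'; rewrite ?uS ?uE //.
    + by move/eqP; rewrite nth_uniq // => /eqP.
    + by move/esym/eqP; rewrite newN.
    + by move/eqP; rewrite newN.
    + exact: inj.
  - move=> i k; rewrite leq_eqVlt => /orP[/eqP-> k6|it k6].
      rewrite !uS; move: k k6; apply: lt6P; by rewrite /= !inE !eqxx ?orbT.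
    rewrite uE //; have := mem i k it k6; rewrite in_setU => /orP[->//|].
    by rewrite !inE => /or3P[] ->; rewrite ?orbT.
  - by rewrite !uE.
  - move=> i k; rewrite leq_eqVlt => /orP[/eqP-> k6|it k6].
      rewrite !uS; move: cys; rewrite /= andbT => /and5P[f1 f2 f3 f4 /andP[f5 f6]].
      by move: k k6; apply: lt6P.
    by rewrite !uE //; apply: layer.
  - move=> i k; rewrite ltnS leq_eqVlt => /orP[/eqP-> k6|it k6] ok.
      by rewrite uE // uS; move: k k6 ok; apply: lt6P.
    by rewrite !uE //; [apply: spoke|apply: ltnW].
have [_ _ _ [m0 _ _] _ _ _ _] := R.
apply: proper_card; apply/properP; split; first exact: subsetUl.
by exists (u t 0) => //; rewrite !inE eqxx orbT.
Qed.

Lemma partial_tube_iso t a (u : nat -> nat -> V) P : partial_tube t a u P ->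
  exists t', isomorphic e (@tube_adj t').
Proof.
have [n] := ubnP (#|V| - #|P|); elim: n t u P => // n IH t u P nP T.
case: (partial_tube_grow T) => [|[u' [P' [T' lt]]]]; first by exists t.
apply: (IH _ _ _ _ T'); exact: leq_trans (ltn_sub2l (leq_trans lt (max_card _)) lt) nP.
Qed.

Lemma cap_tube : has_square_cap G -> exists t, isomorphic e (@tube_adj t).
Proof.
case/(cap_ring)=> a [u0 [u1 [u2 [u3 [u4 [u5 [R u a1 a3 a5]]]]]]].
pose s := [:: u0; u1; u2; u3; u4; u5].
apply: (@partial_tube_iso 0 a (fun _ k => nth a s k) [set x in [:: a; u1; u3; u5]]).
have [us cys _ _ _ _ _ _] := R.
have aN : a \notin s by case/andP: u.
split=> //=.
- by rewrite !inE eqxx.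
- by move=> i k _ k6; apply: contraNneq aN => <-; apply: mem_nth.
- move=> i k i' k'; rewrite !leqn0 => /eqP-> k6 /eqP-> k6' /eqP.
  by rewrite nth_uniq // => /eqP.
- by move=> i k _; move: k; apply: lt6P; rewrite /= !inE eqxx ?orbT.
- move=> i k _; move: cys; rewrite /= andbT => /and5P[f1 f2 f3 f4 /andP[f5 f6]].
  by move: k; apply: lt6P.
Qed.

(** * Growing three squares in a line *)

(* As in [ring6], with the four corners [p1], [p2], [p3], [p4] sending an edge out
   of the patch. *)
Record ring8 P p1 a1 a2 p2 p3 b1 b2 p4 : Prop := Ring8 {
  ring8_uniq : uniq [:: p1; a1; a2; p2; p3; b1; b2; p4];
  ring8_cycle : path.cycle e [:: p1; a1; a2; p2; p3; b1; b2; p4];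
  ring8_in : [/\ a1 \in P, a2 \in P, b1 \in P & b2 \in P];
  ring8_notin : [/\ p1 \notin P, p2 \notin P, p3 \notin P & p4 \notin P];
  ring8_closed : forall p q, p \in P -> e p q ->
    (q \in P) || (q \in [:: p1; p2; p3; p4]);
  ring8_straight : [/\ r a1 p1 = a2, r a2 a1 = p2, r b1 p3 = b2 & r b2 b1 = p4];
  ring8_corner : [/\ r p1 a1 = p4, r p2 p3 = a2, r p3 b1 = p2 & r p4 p1 = b2];
  ring8_out : [/\ r p1 p4 \notin P, r p2 a2 \notin P, r p3 p2 \notin P
                & r p4 b2 \notin P]
}.

Lemma ring8_rot P p1 a1 a2 p2 p3 b1 b2 p4 :
  ring8 P p1 a1 a2 p2 p3 b1 b2 p4 -> ring8 P p3 b1 b2 p4 p1 a1 a2 p2.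
Proof.
case=> u cy [? ? ? ?] [? ? ? ?] cl [? ? ? ?] [? ? ? ?] [? ? ? ?]; split=> //.
- by rewrite -(rot_uniq 4).
- by rewrite -(rot_cycle 4).
- move=> p q pP /(cl _ _ pP); rewrite !inE.
  by case: (q == p1); case: (q == p2); case: (q == p3); case: (q == p4);
    rewrite ?orbT ?orbF.
Qed.

Lemma ring8_adj P p1 a1 a2 p2 p3 b1 b2 p4 : ring8 P p1 a1 a2 p2 p3 b1 b2 p4 ->
  [/\ e p1 a1, e p2 p3, e p3 b1 & e p4 p1].
Proof. by case=> _ /and5P[-> _ _ -> /and5P[-> _ _ ->]]. Qed.

(** Straight at [a1] and [a2], the face of [(p1, a1)] either returns from [p2] to [p1] or leaves the
    patch at [p2] and comes back along the edge going out of [p1]. *)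
Lemma ring8_face P p1 a1 a2 p2 p3 b1 b2 p4 : ring8 P p1 a1 a2 p2 p3 b1 b2 p4 ->
  square p1 a1 a2 p2 \/ hexagon p1 a1 a2 p2 (r p2 a2) (r p1 p4).
Proof.
move=> R; have [e1 _ _ _] := ring8_adj R.
have [_ _ _ _ _ [s1 s2 _ _] [c1 _ _ _] _] := R.
have [c5 _ _] := cubic_rotation e1 c1 erefl.
case: (face_cases e1) => [[c [d sq]]|[c [d [x [y hx]]]]]; [left|right].
  by have [_ r1 r2 _ _] := sq; rewrite -{1}s2 -s1 r1 r2.
have [_ [r1 r2 r3] [r4 r5 r6]] := hx.
have E : y = r p1 p4 by apply: (@perm_inj _ (r p1)); rewrite c5 r6.
by rewrite -E; move: hx; rewrite -r3 -r2 -r1 s1 s2.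
Qed.

(** Let [o3], [o4] be the outer neighbours of [p3], [p4]. The square makes [p1 p2] an edge, so the
    face entering [p4] from [o4] runs [o4 p4 p1 p2 p3], too long for a square. As a hexagon it ends
    with [o3], and together with the given hexagon it makes the rotation at [o4] exchange [p4] and
    [o3]. *)
Lemma ring8_mixed P p1 a1 a2 p2 p3 b1 b2 p4 : ring8 P p1 a1 a2 p2 p3 b1 b2 p4 ->
  square p1 a1 a2 p2 -> hexagon p3 b1 b2 p4 (r p4 b2) (r p3 p2) -> False.
Proof.
move=> R [_ _ _ q1 q2] [uh [_ _ _] [h4 h5 h6]].
have [e1 e2 e3 e4] := ring8_adj R.
have [_ _ _ _ _ _ [c1 c2 c3 c4] _] := R.
have [k1 _ _] := cubic_rotation e1 c1 erefl.
have [k2 _ _] := cubic_rotation e2 c2 q1.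
have [k4 _ N4] := cubic_rotation e4 c4 erefl.
have E12 : r p1 p4 = p2 by apply: (@perm_inj _ (r p1)); rewrite k1 q2.
have e44 : e (r p4 b2) p4 by apply: adjC; rewrite N4 !inE eqxx !orbT.
split_uniq uh.
case: (face_cases e44) => [[c [d [_ f1 f2 f3 f4]]]|].
  by have /eqP : p3 = r p4 b2; [rewrite -f3 -f2 -f1 k4 E12 k2|by_neq].
case=> c [d [x [y [_ [f1 f2 f3] [f4 f5 f6]]]]].
have Ey : y = r p3 p2 by rewrite -f4 -f3 -f2 -f1 k4 E12 k2.
rewrite Ey in f6.
have [_ + _] := cubic_rotation e44 h4 f6.
by rewrite /= !inE eqxx orbT.
Qed.

Record hexes8 P p1 a1 a2 p2 p3 b1 b2 p4 o1 o2 o3 o4 : Prop := Hexes8 {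
  hexes8_ring : ring8 P p1 a1 a2 p2 p3 b1 b2 p4;
  hexes8_out : [/\ o1 = r p1 p4, o2 = r p2 a2, o3 = r p3 p2 & o4 = r p4 b2];
  hexes8_1 : hexagon p1 a1 a2 p2 o2 o1;
  hexes8_2 : hexagon p3 b1 b2 p4 o4 o3
}.

Lemma hexes8_rot P p1 a1 a2 p2 p3 b1 b2 p4 o1 o2 o3 o4 :
  hexes8 P p1 a1 a2 p2 p3 b1 b2 p4 o1 o2 o3 o4 ->
  hexes8 P p3 b1 b2 p4 p1 a1 a2 p2 o3 o4 o1 o2.
Proof. by case=> R [? ? ? ?] h1 h2; split=> //; apply: ring8_rot. Qed.

Lemma ring8_cases P p1 a1 a2 p2 p3 b1 b2 p4 : ring8 P p1 a1 a2 p2 p3 b1 b2 p4 ->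
  (square p1 a1 a2 p2 /\ square p3 b1 b2 p4) \/
  exists o1 o2 o3 o4, hexes8 P p1 a1 a2 p2 p3 b1 b2 p4 o1 o2 o3 o4.
Proof.
move=> R; have R' := ring8_rot R.
case: (ring8_face R) (ring8_face R') => [s1|h1] [s2|h2].
- by left.
- by have := ring8_mixed R s1 h2.
- by have := ring8_mixed R' s2 h1.
- by right; exists (r p1 p4), (r p2 a2), (r p3 p2), (r p4 b2); split.
Qed.

(** Half of the facts about the new boundary; [hexes8_rot] yields the other half. *)
Lemma hexes8_local P p1 a1 a2 p2 p3 b1 b2 p4 o1 o2 o3 o4 :
  hexes8 P p1 a1 a2 p2 p3 b1 b2 p4 o1 o2 o3 o4 ->
  [/\ [/\ e p1 o1, e p2 o2, e o1 o2 & r o2 p2 = o1 /\ r o1 o2 = p1],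
      (forall z, e p1 z = (z \in [:: a1; p4; o1])) /\ r p1 o1 = a1,
      (forall z, e p2 z = (z \in [:: p3; a2; o2])) /\ r p2 o2 = p3,
      o1 \notin [:: p1; p2; p3; p4; o2; o4] &
      o2 \notin [:: p1; p2; p3; p4]].
Proof.
case=> R [E1 E2 E3 E4] [uh [_ _ a3] [h4 h5 h6]] [uk [_ _ b3] [k4 k5 k6]].
have [e1 e2 e3 e4] := ring8_adj R.
have [u _ [i1 i2 i3 i4] [n1 n2 n3 n4] cl _ [c1 c2 c3 c4] [t1 t2 t3 t4]] := R.
have [m1 u1 N1] := cubic_rotation e1 c1 (esym E1).
have [m2 u2 N2] := cubic_rotation e2 c2 (esym E2).
have [m3 u3 N3] := cubic_rotation e3 c3 (esym E3).
have [m4 u4 N4] := cubic_rotation e4 c4 (esym E4).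
have eo1 : e p1 o1 by rewrite N1 !inE eqxx !orbT.
have eo2 : e p2 o2 by rewrite N2 !inE eqxx !orbT.
have eo4 : e p4 o4 by rewrite N4 !inE eqxx !orbT.
have e12 : e o1 o2 by apply: adjC; rewrite -h4; apply: adj_rotation.
rewrite -E1 in t1; rewrite -E2 in t2.
split_uniq u; split_uniq uh; split_uniq uk; split_uniq u1; split_uniq u2.
split_uniq u3; split_uniq u4.
(* Otherwise [p1] and [o2] are neighbours of [p3], which forces [o3 = p1] and then [o2 = b1],
   although [o2] is outside [P]. *)
have o1p3 : o1 != p3.
  apply/eqP=> E; have := e12; rewrite E N3 !inE; by_neq; rewrite ?orbF /=.
  have := adjC eo1; rewrite E N3 !inE; by_neq; rewrite ?orbF /= => /eqP<-; by_neq.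
  by rewrite ?orbF => /eqP h; rewrite h i3 in t2.
have o2p4 : o2 != p4.
  apply/eqP=> E; have := adjC e12; rewrite E N4 !inE; by_neq; rewrite ?orbF /=.
  have := adjC eo2; rewrite E N4 !inE; by_neq; rewrite ?orbF /= => /eqP<-; by_neq.
  by rewrite ?orbF => /eqP h; rewrite h i4 in t1.
(* Otherwise the face of [(o4, p4)] passes through [p1] and is back at [o4] after three steps. *)
have o1o4 : o1 != o4.
  apply/eqP=> E; case: (face_cases (adjC eo4)) => [[c [d [uq f1 f2 f3 f4]]]|].
    move: uq; rewrite -f2 -f1 m4 -E1 E /= !inE eqxx !orbT //.
  case=> c [d [x [y [uq [f1 f2 f3] _]]]].
  by move: uq; rewrite -f2 -f1 m4 -E1 E /= !inE eqxx !orbT.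
by split=> //; rewrite !inE; by_neq.
Qed.

(** Two hexagons turn the old corners into interior vertices and the [o] vertices into corners. The
    sides with three edges are then [o4 p4 p1 o1] and [o2 p2 p3 o3]. *)
Lemma ring8_step P p1 a1 a2 p2 p3 b1 b2 p4 : ring8 P p1 a1 a2 p2 p3 b1 b2 p4 ->
  (square p1 a1 a2 p2 /\ square p3 b1 b2 p4) \/
  exists o1 o2 o3 o4,
    ring8 (P :|: [set x in [:: p1; p2; p3; p4]]) o4 p4 p1 o1 o2 p2 p3 o3.
Proof.
move=> R; case: (ring8_cases R) => [|[o1 [o2 [o3 [o4 H]]]]]; [by left|right].
exists o1, o2, o3, o4.
have [[e1 e2 e12 [f2 f1]] [N1 m1] [N2 m2] l1 l2] := hexes8_local H.
have [[e3 e4 e34 [f4 f3]] [N3 m3] [N4 m4] l3 l4] := hexes8_local (hexes8_rot H).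
have [_ [E1 E2 E3 E4] _ _] := H.
have [u cy [i1 i2 i3 i4] [n1 n2 n3 n4] cl _ [c1 c2 c3 c4] [t1 t2 t3 t4]] := R.
have [_ e23 _ e41] := ring8_adj R.
split_uniq u; split_uniq l1; split_uniq l2; split_uniq l3; split_uniq l4.
rewrite -E1 -E2 -E3 -E4 in t1 t2 t3 t4.
(* Otherwise [o2] and [o4] are both the third neighbour of [o1], and the rotation sends it to [p1]
   as well as to [p3]. *)
have o13 : o1 != o3.
  apply/eqP=> E; have e13 : e o1 p3 by rewrite E adjC.
  have e14 : e o1 o4 by rewrite E.
  have [] := neighbours3 (adjC e1) e13 e12 ltac:(by rewrite /= !inE; by_neq) e14;
    move/eqP; by_neq => // /eqP Eo.
  by move: f3; rewrite Eo -E f1 => /eqP; by_neq.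
have o24 : o2 != o4.
  apply/eqP=> E; have e24 : e o2 p4 by rewrite E adjC.
  have e23' : e o2 o3 by rewrite E adjC.
  have [] := neighbours3 (adjC e2) e24 (adjC e12) ltac:(by rewrite /= !inE; by_neq) e23';
    by move/eqP; by_neq.
have oP o : o \in [:: o1; o2; o3; o4] ->
    (o \notin P) && (o \notin [:: p1; p2; p3; p4]).
  by rewrite !inE => /or4P[] /eqP->; rewrite ?t1 ?t2 ?t3 ?t4 /=; by_neq.
have outN o p z : (o, p) \in [:: (o1, p1); (o2, p2); (o3, p3); (o4, p4)] ->
    e o z -> z != p -> z \notin P :|: [set x in [:: p1; p2; p3; p4]].
  move=> h /adjC ezo zp; have [oo po] : o \in [:: o1; o2; o3; o4] /\
      forall q, q \in [:: p1; p2; p3; p4] -> q != p -> e q o -> False.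
    move: h; rewrite !inE => /or4P[] /eqP[-> ->]; split; rewrite ?eqxx ?orbT // => q;
    rewrite !inE => /or4P[] /eqP->; rewrite ?eqxx //= => _;
    rewrite ?N1 ?N2 ?N3 ?N4 !inE; by_neq; rewrite ?orbF //= => /eqP h;
    first [by move: t1; rewrite h ?i1 ?i2 ?i3 ?i4|by move: t2; rewrite h ?i1 ?i2 ?i3 ?i4|
        by move: t3; rewrite h ?i1 ?i2 ?i3 ?i4|by move: t4; rewrite h ?i1 ?i2 ?i3 ?i4].
  have /andP[oNP oNp] := oP _ oo; rewrite in_setU negb_or; apply/andP; split.
    by apply/negP=> zP; have := cl _ _ zP ezo; rewrite (negPf oNP) (negPf oNp).
  by rewrite inE; apply/negP=> /po/(_ zp ezo).
split.
- by rewrite /= !inE; by_neq.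
- by rewrite /= (adjC e4) e41 e1 e12 (adjC e2) e23 e3 e34.
- by rewrite !inE !eqxx !orbT.
- by rewrite !in_setU !inE (negPf t1) (negPf t2) (negPf t3) (negPf t4); by_neq.
- move=> p q; rewrite in_setU => /orP[pP epq|].
    by have := cl _ _ pP epq; rewrite !inE => /orP[->//|/or4P[] ->]; rewrite ?orbT.
  rewrite inE !in_cons orbF => /or4P[] /eqP->;
  by rewrite ?N1 ?N2 ?N3 ?N4 !inE => /or3P[] /eqP->;
    rewrite ?eqxx ?i1 ?i2 ?i3 ?i4 ?orbT.
- by rewrite -E1 -E3.
- by [].
have [_ z4 _] := cubic_rotation (adjC e4) f4 erefl.
have [_ z1 _] := cubic_rotation e12 f1 erefl.
have [_ z2 _] := cubic_rotation (adjC e2) f2 erefl.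
have [_ z3 _] := cubic_rotation e34 f3 erefl.
split_uniq z1; split_uniq z2; split_uniq z3; split_uniq z4; split.
- by apply: (outN o4 p4); [rewrite !inE eqxx !orbT|apply: adj_rotation|by_neq].
- by apply: (outN o1 p1); [rewrite !inE eqxx|apply: adj_rotation|by_neq].
- by apply: (outN o2 p2); [rewrite !inE eqxx !orbT|apply: adj_rotation|by_neq].
- by apply: (outN o3 p3); [rewrite !inE eqxx !orbT|apply: adj_rotation|by_neq].
Qed.

(** Hexagons strictly enlarge [P], so squares come at last. The inclusion keeps the first line
    inside the patch, which later tells the two lines apart. *)
Lemma ring8_grow P p1 a1 a2 p2 p3 b1 b2 p4 : ring8 P p1 a1 a2 p2 p3 b1 b2 p4 ->
  exists P' q1 c1 c2 q2 q3 d1 d2 q4,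
    [/\ ring8 P' q1 c1 c2 q2 q3 d1 d2 q4, P \subset P',
        square q1 c1 c2 q2 & square q3 d1 d2 q4].
Proof.
have [n] := ubnP (#|V| - #|P|).
elim: n P p1 a1 a2 p2 p3 b1 b2 p4 => // n IH P p1 a1 a2 p2 p3 b1 b2 p4 nP R.
case: (ring8_step R) => [[s1 s2]|[o1 [o2 [o3 [o4 R']]]]].
  by exists P, p1, a1, a2, p2, p3, b1, b2, p4.
have [_ _ _ [n1 _ _ _] _ _ _ _] := R.
have lt : #|P| < #|P :|: [set x in [:: p1; p2; p3; p4]]|.
  apply: proper_card; apply/properP; split; first exact: subsetUl.
  by exists p1 => //; rewrite !inE eqxx orbT.
have [|P' [q1 [c1 [c2 [q2 [q3 [d1 [d2 [q4 [R2 sub s1 s2]]]]]]]]]] :=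
  IH _ _ _ _ _ _ _ _ _ _ R'.
  exact: leq_trans (ltn_sub2l (leq_trans lt (max_card _)) lt) nP.
exists P', q1, c1, c2, q2, q3, d1, d2, q4; split=> //.
by apply: subset_trans sub; apply: subsetUl.
Qed.

(** The outgoing edges are now [p1 p2] and [p3 p4], and the rotations at the corners close up the
    middle square of the opposite line. *)
Lemma ring8_end P p1 a1 a2 p2 p3 b1 b2 p4 : ring8 P p1 a1 a2 p2 p3 b1 b2 p4 ->
  square p1 a1 a2 p2 -> square p3 b1 b2 p4 -> square p2 p3 p4 p1.
Proof.
move=> R [_ _ _ s1 s2] [_ _ _ s3 s4]; have [e1 e2 e3 e4] := ring8_adj R.
have [u _ _ _ _ _ [c1 c2 c3 c4] _] := R.
have [k1 _ _] := cubic_rotation e1 c1 erefl.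
have [k2 _ _] := cubic_rotation e2 c2 s1.
have [k3 _ _] := cubic_rotation e3 c3 erefl.
have [k4 _ _] := cubic_rotation e4 c4 s3.
split_uniq u; split=> //; first by rewrite /= !inE; by_neq.
- by apply: (@perm_inj _ (r p3)); rewrite k3 s4.
- by apply: (@perm_inj _ (r p1)); rewrite k1 s2.
Qed.

(** * A line of three squares and its partner *)

(** The vertex set of a face does not depend on the direction of the cycle, so it serves to tell
    faces apart. *)
Lemma bounds_sources (c : seq V) F : bounds c F ->
  [set d.1 | d in F] = [set x in c].
Proof.
have aux (s : seq V) : [set d.1 | d in cycle_darts s] = [set x in s].
  apply/setP=> x; rewrite inE; apply/imsetP/idP => [[d]|].
    rewrite inE => /(map_f fst) h ->; move: h.
    by rewrite -/(unzip1 _) unzip1_zip ?size_rot.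
  rewrite -{1}(unzip1_zip (_ : size s <= size (rot 1 s))) ?size_rot // => /mapP[d ds ->].
  by exists d; rewrite // inE.
case/and3P=> _ _ /orP[] /eqP->; rewrite aux //.
by apply/setP=> x; rewrite !inE mem_rev.
Qed.

Lemma line_of_squares v1 v2 v3 v4 u1 u2 u3 u4 :
  uniq [:: v1; v2; v3; v4; u1; u2; u3; u4] ->
  e u1 u2 -> e u2 u3 -> e u3 u4 ->
  square u1 u2 v2 v1 -> square u2 u3 v3 v2 -> square u3 u4 v4 v3 ->
  in_line (cycle_darts [:: u1; u2; v2; v1]) (cycle_darts [:: u2; u3; v3; v2])
    (cycle_darts [:: u3; u4; v4; v3]).
Proof.
move=> u e1 e2 e3 s1 s2 s3; exists v1, v2, v3, v4, u1, u2, u3, u4.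
have u' := u; split_uniq u'.
split=> //; first by split; apply: square_face.
- by apply/and3P; split; rewrite //= ?eqxx ?orbT // !inE; by_neq.
- by apply/and3P; split; rewrite //= ?eqxx ?orbT // !inE; by_neq.
- by apply/and3P; split; rewrite //= ?eqxx ?orbT // !inE; by_neq.
Qed.

Lemma in_line_uniq (F1 F2 F3 : {set V * V}) : in_line F1 F2 F3 -> uniq [:: F1; F2; F3].
Proof.
move=> [v1 [v2 [v3 [v4 [u1 [u2 [u3 [u4 [u _ B1 B2 B3]]]]]]]]].
have [S1 S2 S3] := And3 (bounds_sources B1) (bounds_sources B2) (bounds_sources B3).
split_uniq u; rewrite /= !inE negb_or andbT -andbA; apply/and3P; split; apply/eqP=> E.
- by move/setP/(_ v1): S1; rewrite E S2 !inE eqxx; by_neq.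
- by move/setP/(_ v1): S1; rewrite E S3 !inE eqxx; by_neq.
- by move/setP/(_ v2): S2; rewrite E S3 !inE eqxx; by_neq.
Qed.

Lemma square_facesW F : F \in square_faces G -> F \in face_set G.
Proof. by rewrite inE => /andP[]. Qed.

(* [F] already traverses the edge from [b] to [c], so [F'] goes from [c] to [b]. *)
Lemma adjacent_square F F' a b c d x y :
  F \in face_set G -> F = cycle_darts [:: a; b; c; d] ->
  uniq [:: a; b; c; d; x; y] -> F' \in face_set G -> bounds [:: c; y; x; b] F' ->
  F' = cycle_darts [:: b; x; y; c].
Proof.
move=> FG FE u F'G /and3P[_ _ /orP[] /eqP E]; last exact: E.
have bF : (b, c) \in F by rewrite FE !inE eqxx orbT.
have bF' : (b, c) \in F' by rewrite E !inE eqxx !orbT.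
have : (c, y) \in F by rewrite (face_mem_eq FG bF) -(face_mem_eq F'G bF') E !inE eqxx.
by rewrite FE !inE !xpair_eqE; split_uniq u; by_neq; rewrite /= andbF.
Qed.

(** Once the three squares are traversed coherently, they give the first patch: the four inner
    vertices have all their edges in it. *)
Lemma line_ring F1 F2 F3 : in_line F1 F2 F3 ->
  exists v1 v2 v3 v4 u1 u2 u3 u4,
    [/\ bounds [:: v1; v2; u2; u1] F1, bounds [:: v2; v3; u3; u2] F2,
        bounds [:: v3; v4; u4; u3] F3, e u2 v2 /\ e u3 v3 &
        ring8 [set x in [:: v2; v3; u2; u3]] v1 v2 v3 v4 u4 u3 u2 u1].
Proof.
move=> [v1 [v2 [v3 [v4 [u1 [u2 [u3 [u4 [u [Q1 Q2 Q3] B1 B2 B3]]]]]]]]].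
(* Exchanging the rows [v] and [u] reverses the direction of the listed cycles; the direction of
   [F1] then settles those of [F2] and [F3]. *)
wlog E1 : v1 v2 v3 v4 u1 u2 u3 u4 u B1 B2 B3 / F1 = cycle_darts [:: u1; u2; v2; v1].
  move=> H; have /and3P[_ _ /orP[] /eqP E] := B1; last first.
    by apply: (H v1 v2 v3 v4 u1 u2 u3 u4).
  have flip (p q s t : V) F : bounds [:: p; q; s; t] F -> bounds [:: t; s; q; p] F.
    case/and3P=> h1 _ h2; apply/and3P; split=> //; last by rewrite orbC.
    by rewrite -rev_uniq.
  apply: (H u1 u2 u3 u4 v1 v2 v3 v4) => //; try exact: flip.
  by rewrite -(rot_uniq 4).
have [G1 G2 G3] := And3 (square_facesW Q1) (square_facesW Q2) (square_facesW Q3).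
have u' := u; split_uniq u'.
have E2 : F2 = cycle_darts [:: u2; u3; v3; v2].
  by apply: adjacent_square G1 E1 _ G2 B2; rewrite /= !inE; by_neq.
have E3 : F3 = cycle_darts [:: u3; u4; v4; v3].
  by apply: adjacent_square G2 E2 _ G3 B3; rewrite /= !inE; by_neq.
have [[_ r1 r2 r3 r4] e1] : square u1 u2 v2 v1 /\ e u1 u2.
  by apply: face_square G1 _ E1; rewrite /= !inE; by_neq.
have [[_ s1 s2 s3 s4] e2] : square u2 u3 v3 v2 /\ e u2 u3.
  by apply: face_square G2 _ E2; rewrite /= !inE; by_neq.
have [[_ t1 t2 t3 t4] e3] : square u3 u4 v4 v3 /\ e u3 u4.
  by apply: face_square G3 _ E3; rewrite /= !inE; by_neq.
have f2 : e u2 v2 by rewrite -r1 adj_rotation.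
have g1 : e v2 v1 by rewrite -r2 adj_rotation.
have f1 : e v1 u1 by rewrite -r3 adj_rotation.
have f3 : e u3 v3 by rewrite -s1 adj_rotation.
have g2 : e v3 v2 by rewrite -s2 adj_rotation.
have f4 : e u4 v4 by rewrite -t1 adj_rotation.
have g3 : e v4 v3 by rewrite -t2 adj_rotation.
have [k1 _ M1] := cubic_rotation (adjC g2) s3 r2.
have [k2 _ M2] := cubic_rotation (adjC g3) t3 s2.
have [k3 _ M3] := cubic_rotation (adjC e2) s1 t4.
have [k4 _ M4] := cubic_rotation (adjC e1) r1 s4.
exists v1, v2, v3, v4, u1, u2, u3, u4; split=> //; split=> //.
- by rewrite /= !inE; by_neq.
- by rewrite /= !andbT (adjC g1) (adjC g2) (adjC g3) (adjC f4)
    (adjC e3) (adjC e2) (adjC e1) (adjC f1).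
- by rewrite !inE !eqxx !orbT.
- by rewrite !inE; by_neq.
- move=> p q; rewrite inE !in_cons orbF => /or4P[] /eqP->;
  by rewrite ?M1 ?M2 ?M3 ?M4 !inE => /or3P[] /eqP->; rewrite ?eqxx ?orbT.
have out p q z : r p q = z -> e p q ->
    (forall w, w \in [:: v2; v3; u2; u3] -> e p w -> w \in [:: q; z]) ->
    r p z \notin [set x in [:: v2; v3; u2; u3]].
  move=> E epq H; have [_ uz Nz] := cubic_rotation epq E erefl.
  rewrite inE; apply/negP=> /H; rewrite Nz !inE !eqxx !orbT => /(_ isT).
  by case/orP=> /eqP h; move: uz; rewrite h /= !inE eqxx ?orbT ?andbF.
split.
- apply: (out _ v2) => // [|w]; first exact: adjC.
  by rewrite !inE => /or4P[] /eqP-> /adjC;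
    rewrite ?M1 ?M2 ?M3 ?M4 !inE; by_neq; rewrite ?eqxx ?orbT.
- apply: (out _ u4) => // [|w]; first exact: adjC.
  by rewrite !inE => /or4P[] /eqP-> /adjC;
    rewrite ?M1 ?M2 ?M3 ?M4 !inE; by_neq; rewrite ?eqxx ?orbT.
- apply: (out _ u3) => // [|w]; first exact: adjC.
  by rewrite !inE => /or4P[] /eqP-> /adjC;
    rewrite ?M1 ?M2 ?M3 ?M4 !inE; by_neq; rewrite ?eqxx ?orbT.
- apply: (out _ v1) => // [|w]; first exact: adjC.
  by rewrite !inE => /or4P[] /eqP-> /adjC;
    rewrite ?M1 ?M2 ?M3 ?M4 !inE; by_neq; rewrite ?eqxx ?orbT.
Qed.

Lemma line_partner (F1 F2 F3 : {set V * V}) : in_line F1 F2 F3 ->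
  has_square_cap G \/
  exists F4 F5 F6, in_line F4 F5 F6 /\ uniq [:: F1; F2; F3; F4; F5; F6].
Proof.
move=> L; have L3 := in_line_uniq L.
have [v1 [v2 [v3 [v4 [u1 [u2 [u3 [u4 [B1 B2 B3 [f2 f3] R]]]]]]]]] := line_ring L.
have [u cy _ _ _ _ _ _] := R.
case: (ring8_step R) => [[[_ _ _ s _] _]|[o1 [o2 [o3 [o4 R']]]]].
  (* Closing at once makes [v1 v4] an edge, and the cap has centre [v2] and 6-cycle
     [v1 v4 v3 u3 u2 u1]. *)
  left; move: cy; rewrite /= andbT => /and5P[g1 g2 g3 g4 /and4P[g5 g6 g7 g8]].
  have e41 : e v4 v1 by rewrite -s; apply: adj_rotation.
  split_uniq u; exists v1, v4, v3, u3, u2, u1, v2; split.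
  - by rewrite /= !inE; by_neq.
  - by rewrite /= g6 g7 g8 (adjC e41) (adjC g3) (adjC f3).
  - by split=> //; apply: adjC.
right.
(* One step has already been made, so [P] contains all eight vertices of the first line, whereas
   each new square has [q2] or [q3], outside [P], among its vertices. *)
have [P [q1 [c1 [c2 [q2 [q3 [d1 [d2 [q4 [R2 /subsetP sub s1 s2]]]]]]]]]] := ring8_grow R'.
have s3 := ring8_end R2 s1 s2.
have [u' cy' _ [_ n2 n3 _] _ _ _ _] := R2.
move: cy'; rewrite /= andbT => /and5P[g1 g2 g3 g4 /and4P[g5 g6 g7 g8]].
pose F4 : {set V * V} := cycle_darts [:: c2; q2; q1; c1].
pose F5 : {set V * V} := cycle_darts [:: q2; q3; q4; q1].
pose F6 : {set V * V} := cycle_darts [:: q3; d1; d2; q4].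
have L' : in_line F4 F5 F6.
  apply: line_of_squares => //; first by split_uniq u'; rewrite /= !inE; by_neq.
  exact: square_rot (square_rot s1).
exists F4, F5, F6; split; first exact: L'.
rewrite -[X in is_true X]/(uniq ([:: F1; F2; F3] ++ [:: F4; F5; F6])).
rewrite cat_uniq L3 (in_line_uniq L') andbT /=.
have old F (d : V * V) : F \in [:: F1; F2; F3] -> d \in F -> d.1 \in P.
  move=> FF dF; apply: sub.
  have : d.1 \in [set d.1 | d in F] by apply: imset_f.
  move: FF; rewrite !inE => /or3P[] /eqP->;
  by rewrite ?(bounds_sources B1) ?(bounds_sources B2) ?(bounds_sources B3) !inE
    => /or4P[] ->; rewrite ?orbT.
apply/norP; split; [|apply/norP; split; [|rewrite orbF]]; apply/negP=> /old H.
- by have := H (q2, q1) ltac:(by rewrite !inE eqxx ?orbT); rewrite (negPf n2).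
- by have := H (q2, q3) ltac:(by rewrite !inE eqxx ?orbT); rewrite (negPf n2).
- by have := H (q3, d1) ltac:(by rewrite !inE eqxx ?orbT); rewrite (negPf n3).
Qed.

End Fullerene.

(** * Classification into the five types *)

Theorem theorem2p11 (G : plane_graph) (hG : is_46_fullerene G) :
  is_cube G \/ is_hexagonal_prism G \/ is_tubular G \/
  lantern_structure G \/ dispersive_structure G.
Proof.
have cap : has_square_cap G -> is_cube G \/ is_tubular G.
  move=> /(cap_tube hG)[[|t] iso]; last by right; exists t.+1.
  by left; apply: isomorphic_trans iso tube0_cube.
case: (classic (has_square_cap G)) => [/cap[]|noCap]; try by tauto.
case: (classic (has_three_in_line G)) => [[F1 [F2 [F3 L]]]|]; last first.
  by move=> noLine; do 4!right.
case: (classic (is_cube G)) => [|notCube]; first by left.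
case: (classic (is_hexagonal_prism G)) => [|notPrism]; first by right; left.
do 3!right; left; split=> //.
case: (line_partner hG L) => [/noCap //|[F4 [F5 [F6 [L' u]]]]].
exists F1, F2, F3, F4, F5, F6; split=> //.
have [_ [_ [_ [_ [_ [_ [_ [_ [_ [Q1 Q2 Q3] _ _ _]]]]]]]]] := L.
have [_ [_ [_ [_ [_ [_ [_ [_ [_ [Q4 Q5 Q6] _ _ _]]]]]]]]] := L'.
rewrite perm_sym; apply: uniq_perm => //; first exact: enum_uniq.
(* Six distinct square faces exhaust the square faces, as there are exactly six. *)
apply: (uniq_min_size u _ _).2; last by rewrite -cardE; case: hG => _ _ ->.
by apply/allP; rewrite /= !mem_enum Q1 Q2 Q3 Q4 Q5 Q6.
Qed.
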